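(* Let $n\ge1$ and $\delta\in(0,1/2)$. Assume that the noise $\epsilon=Y-g(X)$ is sub-Gaussian conditionally on $X$ with parameter $\sigma^2$, that $g$ is Lipschitz on $S_X$, and that the local map $\mathcal V$ (possibly random and data-dependent) is VC with dimension $v$. Then, with probability at least $1-2\delta$, for all $x\in S_X$, $$|\hat g_{\mathcal V}(x)-g(x)|\ \le\ \sqrt{\frac{2\sigma^2\log\left(\frac{(n+1)^v}{\delta}\right)}{n\,\mathbb P_n(\mathcal V(x))}}\ +\ L(\mathcal V(x))\,\operatorname{diam}(\mathcal V(x)).$$
   Context: Regression model: $(X,Y)$ is a random vector, $X$ takes values in $S_X\subset\mathbb R^d$ ($d\ge1$), $Y$ is real valued, $g(x)=\mathbb E[Y\mid X=x]$, $\epsilon=Y-g(X)$; $(X_1,Y_1),\dots,(X_n,Y_n)$ are i.i.d. copies of $(X,Y)$. For a set $A$, $\mathbb P_n(A)=\frac1n\sum_{i=1}^n\mathbf 1_A(X_i)$. Conditionally sub-Gaussian with parameter $\sigma^2$: $\mathbb E[\epsilon\mid X]=0$ and $\mathbb E[\exp(t\epsilon)\mid X]\le \exp(\sigma^2t^2/2)$ for all $t\in\mathbb R$. A local map is a map $\mathcal V:S_X\to\mathcal B(S_X)$ (Borel subsets of $S_X$) with $x\in\mathcal V(x)$ for all $x$, each $\mathcal V(x)$ having positive Lebesgue measure. It may be random and may depend on the whole sample and on additional randomness. The associated estimator is $\hat g_{\mathcal V}(x)=\frac{\sum_{i=1}^nY_i\mathbf 1_{\mathcal V(x)}(X_i)}{\sum_{i=1}^n\mathbf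 1_{\mathcal V(x)}(X_i)}$, with $0/0=0$. $\mathcal V$ is VC with dimension $v$ if $\{\mathcal V(x):x\in S_X\}\subset\mathcal A$ for a fixed (deterministic) collection $\mathcal A$ of subsets of $\mathbb R^d$ with finite Vapnik–Chervonenkis dimension $v$ (largest size of a finite set shattered by $\mathcal A$). $\operatorname{diam}(V)=\sup_{x,y\in V}\|x-y\|_2$. For $V\subset S_X$, $L(V)$ is the smallest constant $L$ with $|g(x)-g(y)|\le L\|x-y\|_2$ for all $x,y\in V$. The right-hand side is read as $+\infty$ if $\mathbb P_n(\mathcal V(x))=0$.
   Formalization: The local map is a function of the sample and of a random element having a regular conditional law given the sample, and ''with probability at least'' means outer probability under their joint law; for arbitrary nonmeasurable random local maps the claim fails. *)

(* Defs.v *)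
From HB Require Import structures.
From mathcomp Require Import all_boot all_order all_algebra.
From mathcomp Require Import all_classical all_reals all_analysis.

Set Implicit Arguments.
Unset Strict Implicit.
Unset Printing Implicit Defensive.

Import Order.TTheory GRing.Theory Num.Theory.

Local Open Scope classical_set_scope.
Local Open Scope ring_scope.
Local Open Scope ereal_scope.

(* MathComp-Analysis development. [R^d] is [d.-tuple R], whose measurable sets
   are the product sigma-algebra of the Borel sets of [R], i.e. the Borel sets
   of [R^d]. *)

Section Euclidean.
Context {R : realType} {d : nat}.
Implicit Types (x y a b : d.-tuple R) (A V : set (d.-tuple R)).
Implicit Type g : d.-tuple R -> R.

Definition dist2 x y : R :=
  Num.sqrt (\sum_(i < d) (tnth x i - tnth y i) ^+ 2)%R.

Definition diam2 V : \bar R :=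
  ereal_sup [set (dist2 p.1 p.2)%:E | p in V `*` V].

Definition lipschitz_with g V (L : R) : Prop :=
  forall x y, V x -> V y -> (`|g x - g y| <= L * dist2 x y)%R.

(* The infimum is attained as soon as it is finite. *)
Definition lipschitz_const g V : \bar R :=
  ereal_inf [set L%:E | L in [set L | (0 <= L)%R /\ lipschitz_with g V L]].

Definition box a b : set (d.-tuple R) :=
  [set x | forall i, (tnth a i < tnth x i <= tnth b i)%R].

Definition box_volume a b : R :=
  (\prod_(i < d) Num.max 0 (tnth b i - tnth a i))%R.

(* Lebesgue outer measure of [R^d], which is Lebesgue measure on Borel sets. *)
Definition lebesgue_vol A : \bar R :=
  ereal_inf [set \sum_(0 <= k <oo) (box_volume (ab k).1 (ab k).2)%:E
            | ab in [set ab : nat -> d.-tuple R * d.-tuple R |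
                      A `<=` \bigcup_k box (ab k).1 (ab k).2]].

End Euclidean.

Section VapnikChervonenkis.
Context {T : Type}.
Implicit Types (C : set (set T)) (F : set T).

Definition shatters C F : Prop :=
  forall B, B `<=` F -> exists2 A, C A & A `&` F = B.

Definition vc_dimension C (v : nat) : Prop :=
  (exists2 F, (F #= `I_v)%card & shatters C F) /\
  (forall m F, (F #= `I_m)%card -> shatters C F -> (m <= v)%N).

End VapnikChervonenkis.

Section Regression.
Context {R : realType} {d : nat} {dO : measure_display}
        {Omega : measurableType dO} (P : probability Omega R).
Implicit Types (X : {RV P >-> d.-tuple R}) (Y : {RV P >-> R}).

(* [h] is a version of [x |-> E[Z | X = x]]. *)
Definition cond_expectation X (Z : Omega -> R) (h : d.-tuple R -> R) : Prop :=
  [/\ P.-integrable setT (EFin \o Z),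
      measurable_fun setT h,
      P.-integrable setT (EFin \o (h \o X)) &
      forall B, measurable B ->
        \int[P]_(w in X @^-1` B) (Z w)%:E =
        \int[P]_(w in X @^-1` B) (h (X w))%:E].

Definition cond_subgaussian X (eps : Omega -> R) (sigma : R) : Prop :=
  cond_expectation X eps (fun=> 0%R) /\
  forall t : R, exists2 h : d.-tuple R -> R,
    cond_expectation X (fun w => expR (t * eps w)%R) h &
    {ae P, forall w, (h (X w) <= expR (sigma ^+ 2 * t ^+ 2 / 2))%R}.

Definition noise X Y (g : d.-tuple R -> R) : Omega -> R :=
  fun w => (Y w - g (X w))%R.

Definition iid_copies n (X_ : 'I_n -> {RV P >-> d.-tuple R})
    (Y_ : 'I_n -> {RV P >-> R}) X Y : Prop :=
  (forall (i : 'I_n) (C : set (d.-tuple R * R)), measurable C ->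
     P [set w | C (X_ i w, Y_ i w)] = P [set w | C (X w, Y w)]) /\
  (forall C : 'I_n -> set (d.-tuple R * R), (forall i, measurable (C i)) ->
     P [set w | forall i, C i (X_ i w, Y_ i w)] =
     \prod_(i < n) P [set w | C i (X_ i w, Y_ i w)]).

Definition sample n (X_ : 'I_n -> {RV P >-> d.-tuple R})
    (Y_ : 'I_n -> {RV P >-> R}) : Omega -> n.-tuple (d.-tuple R * R) :=
  fun w => [tuple (X_ i w, Y_ i w) | i < n].

(* [U] has a (regular) conditional distribution given [S]; [U] may depend on
   [S], and independence of [U] and [S] is the case of a constant kernel. *)
Definition drawn_given dS (TS : measurableType dS) dU (TU : measurableType dU)
    (S : Omega -> TS) (U : Omega -> TU) : Prop :=
  exists kappa : R.-pker TS ~> TU, forall C : set (TS * TU), measurable C ->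
    P [set w | C (S w, U w)] = \int[P]_w kappa (S w) (xsection C (S w)).

(* The local map is a function of the sample and of [U], so an event about it is
   a set of pairs (sample, value of [U]), weighed by the law of that pair. The
   event "for all x in S_X" is an uncountable intersection and need not be
   measurable; the outer probability [mu_ext joint_law] is defined for it and is
   the ordinary probability on measurable events. *)
Definition joint_law n (X_ : 'I_n -> {RV P >-> d.-tuple R})
    (Y_ : 'I_n -> {RV P >-> R}) dU (TU : measurableType dU)
    (U : {RV P >-> TU}) :
    set (n.-tuple (d.-tuple R * R) * TU) -> \bar R :=
  pushforward P (fun w => (sample X_ Y_ w, U w)).

Lemma measurable_sample n (X_ : 'I_n -> {RV P >-> d.-tuple R})
    (Y_ : 'I_n -> {RV P >-> R}) : measurable_fun setT (sample X_ Y_).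
Proof.
apply/measurable_fun_tnthP => i.
rewrite (_ : _ \o _ = fun w => (X_ i w, Y_ i w)); first exact: measurable_fun_pair.
by apply/funext => w /=; rewrite tnth_mktuple.
Qed.

Lemma mu_ext_joint_law n (X_ : 'I_n -> {RV P >-> d.-tuple R})
    (Y_ : 'I_n -> {RV P >-> R}) dU (TU : measurableType dU)
    (U : {RV P >-> TU}) E : measurable E ->
  mu_ext (joint_law X_ Y_ U) E = P [set w | E (sample X_ Y_ w, U w)].
Proof.
have mf : measurable_fun setT (fun w => (sample X_ Y_ w, U w)).
  by apply: measurable_fun_pair => //; exact: measurable_sample.
pose mu := measure_function_pushforward__canonical__measure_function_Measure P mf.
by move=> mE; exact: (measurable_mu_extE mu).
Qed.

End Regression.

Section LocalMaps.
Context {R : realType} {d n : nat}.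
Implicit Types (SX A : set (d.-tuple R)) (s : n.-tuple (d.-tuple R * R)).

Definition local_map SX (V : d.-tuple R -> set (d.-tuple R)) : Prop :=
  forall x, SX x ->
    [/\ V x x, V x `<=` SX, measurable (V x) & 0 < lebesgue_vol (V x)].

(* A single class [C] works for all samples [s] and all values [u] of the
   additional randomness. *)
Definition vc_local_map (TU : Type) SX
    (V : n.-tuple (d.-tuple R * R) -> TU -> d.-tuple R -> set (d.-tuple R))
    (v : nat) : Prop :=
  exists2 C, vc_dimension C v & forall s u x, SX x -> C (V s u x).

Definition empirical_measure s A : R :=
  ((n%:R)^-1 * \sum_(i < n) \1_A (tnth s i).1)%R.

(* Division by zero is zero, which is the convention [0 / 0 = 0]. *)
Definition local_estimator s A : R :=
  ((\sum_(i < n) (tnth s i).2 * \1_A (tnth s i).1) /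
   (\sum_(i < n) \1_A (tnth s i).1))%R.

(* When [g] is constant on an unbounded [A], the second term is [0 * +oo = 0],
   the strongest reading of the bound. *)
Definition error_bound g (sigma delta : R) (v : nat) s A : \bar R :=
  if empirical_measure s A == 0%R then +oo
  else (Num.sqrt (2 * sigma ^+ 2 * ln (n.+1%:R ^+ v / delta) /
                  (n%:R * empirical_measure s A)))%:E
       + lipschitz_const g A * diam2 A.

End LocalMaps.

(* Main.v *)
Require Import Defs.
From HB Require Import structures.
From mathcomp Require Import all_boot all_order all_algebra.

(** Let A be the cell of the query point x, I the set of the indices i with
    X_i in A, and k = |I|; only k > 0 matters, as the bound is infinite for
    k = 0. The weights of the estimator then sum to one, so its error at x is
    the mean over I of the residuals Y_i - g(X_i) plus the mean over I of
    g(X_i) - g(x). The second mean is at most L(A) diam(A), because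
    x and the X_i lie in A ([local_estimator_error]). A violation of the bound,
    whatever x is, therefore forces the event E_I that the sum of the residuals
    over I exceeds sqrt(2 sigma^2 k ln((n+1)^v / delta)) in absolute value, for
    a set I which a member of the VC class cuts out of the design
    (X_1, ..., X_n). Given the design, E_I has probability at most
    2 delta / (n+1)^v ([subgaussian_tail]) and at most (n+1)^v sets I are cut
    out ([card_traces], the Sauer-Shelah lemma), so the union bound gives
    2 delta.

    The difficulty is to make sense of << given the design >>: the family of
    the sets cut out of a design is an arbitrary function of the design, since
    the VC class is arbitrary, and the bad event need not be measurable. As
    the probability of the good event is an outer one, it suffices to bound
    the mass of every measurable D inside the bad event
    ([mu_ext_ge_complement]). This is done in two moves.
    - The kernel that draws U replaces D by a measurable set of samples, each
      of which is completed to a bad pair by some u ([drawn_given_shadow]).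
    - In measurable sets of samples one finds, up to a small mass, measurable
      subsets with a measurable projection to the space of designs
      ([inner_approximable_sample], [measurable_projection]): fibres are made
      compact in the responses, and compactness lets projections commute with
      decreasing intersections. Splitting D by the list of the events E_I that
      hold and projecting the pieces gives finitely many measurable sets of
      designs which tell, at each design, which lists occur there; one finite
      family of indices I for each possible answer covers D, and this choice
      is a measurable function of the design ([measure_selected_le]).

    The tail bound is proved in the form P(E_I and design in M) <=
    2 exp(- Lambda) P(design in M) for measurable M, where Lambda stands for
    ln((n+1)^v / delta); it does not mention conditional distributions. In E[1_M exp(t sum_I (Y_i - g(X_i)))] the
    residuals are removed one at a time: with Y_i erased, the rest of the
    sample is independent of Y_i given X_i, so exp(t (Y_i - g(X_i))) may be
    replaced by its conditional mean given X_i, which is at most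
    exp(sigma^2 t^2 / 2) ([integral_exp_residual], [exp_residual_sum_le]). *)

Set Implicit Arguments.
Unset Strict Implicit.
Unset Printing Implicit Defensive.

(** * The Sauer-Shelah lemma for finite families *)

Definition fshatters (T : finType) (F : {set {set T}}) (J : {set T}) : bool :=
  [forall B in powerset J, [exists A in F, A :&: J == B]].

Lemma fshattersP (T : finType) (F : {set {set T}}) (J : {set T}) :
  reflect (forall B : {set T}, B \subset J -> exists2 A, A \in F & A :&: J = B)
          (fshatters F J).
Proof.
apply: (iffP forall_inP) => [sh B BJ|sh B].
  have /exists_inP[A AF /eqP <-] : [exists A in F, A :&: J == B].
    by apply: sh; rewrite powersetE.
  by exists A.
by rewrite powersetE => /sh[A AF <-]; apply/exists_inP; exists A.
Qed.

(** Pajor's form of the Sauer-Shelah lemma. Pick x that belongs to some but not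
    all members of F and split F into F1 (x inside) and F0 (x outside). No set
    shattered by F1 or by F0 contains x; a set J shattered by both accounts for
    the two sets J and x |: J shattered by F. *)
Lemma leq_card_fshatters (T : finType) (F : {set {set T}}) :
  #|F| <= #|[set J | fshatters F J]|.
Proof.
have [m] := ubnP #|F|; elim: m F => // m IH F Fm.
have [F1|] := leqP #|F| 1.
  have [->|/set0Pn[A AF]] := eqVneq F set0; first by rewrite cards0.
  apply: (leq_trans F1); apply/card_gt0P; exists set0; rewrite inE.
  by apply/fshattersP => B; rewrite subset0 => /eqP ->; exists A; rewrite ?setI0.
case/card_gt1P => A [B [AF BF AB]].
have {A B AF BF AB} [x [A [B [AF BF xA xB]]]] :
    exists x A B, [/\ A \in F, B \in F, x \in A & x \notin B].
  move: AB; rewrite eqEsubset negb_and => /orP[]/subsetPn[x x1 x2].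
    by exists x, A, B.
  by exists x, B, A.
pose F1 := [set A in F | x \in A]; pose F0 := [set A in F | x \notin A].
pose sh (G : {set {set T}}) := [set J | fshatters G J].
have cF : #|F| = #|F1| + #|F0|.
  rewrite -(cardsID [set A : {set T} | x \in A] F); congr (_ + _); apply: eq_card => C.
    by rewrite !inE.
  by rewrite !inE andbC.
have F1_gt0 : 0 < #|F1| by apply/card_gt0P; exists A; rewrite inE AF.
have F0_gt0 : 0 < #|F0| by apply/card_gt0P; exists B; rewrite inE BF.
have IH1 : #|F1| <= #|sh F1|.
  by apply: IH; rewrite -ltnS (leq_trans _ Fm)// cF ltnS -addn1 leq_add2l.
have IH0 : #|F0| <= #|sh F0|.
  by apply: IH; rewrite -ltnS (leq_trans _ Fm)// cF ltnS -add1n leq_add2r.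
have shS (G : {set {set T}}) : G \subset F -> sh G \subset sh F.
  move=> /subsetP GF; apply/subsetP => J; rewrite !inE => /fshattersP shJ.
  by apply/fshattersP => C /shJ[A' /GF A'F <-]; exists A'.
have nsh1 J : J \in sh F1 -> x \notin J.
  rewrite inE => /fshattersP/(_ set0 (sub0set _))[C]; rewrite !inE => /andP[_ xC].
  by move=> /setP/(_ x); rewrite !inE xC => /= ->.
have nsh0 J : J \in sh F0 -> x \notin J.
  rewrite inE => /fshattersP/(_ J (subxx _))[C]; rewrite !inE => /andP[_ xC].
  by move=> /setP/(_ x); rewrite !inE (negbTE xC) => /= <-.
pose both := [set x |: J | J in sh F1 :&: sh F0].
have cboth : #|both| = #|sh F1 :&: sh F0|.
  apply: card_in_imset => J K; rewrite inE => /andP[/nsh1 xJ _].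
  rewrite inE => /andP[/nsh1 xK _] /setP JK; apply/setP => y.
  have := JK y; rewrite !inE; case: eqP => //= -> _.
  by rewrite (negbTE xJ) (negbTE xK).
have dis : [disjoint sh F1 :|: sh F0 & both].
  rewrite disjoint_subset; apply/subsetP => J JU; rewrite inE.
  apply/negP => /imsetP[K _ JK].
  have : x \notin J by move: JU; rewrite inE => /orP[/nsh1|/nsh0].
  by rewrite JK !inE eqxx.
rewrite cF (leq_trans (leq_add IH1 IH0))// -cardsUI -cboth.
have := (leq_card_setU (sh F1 :|: sh F0) both).2; rewrite dis => /eqP <-.
apply: subset_leq_card; rewrite !subUset !shS//; last 2 first.
- by apply/subsetP => C; rewrite inE => /andP[].
- by apply/subsetP => C; rewrite inE => /andP[].
apply/subsetP => K /imsetP[J]; rewrite !inE => /andP[shJ1 shJ0] ->{K}.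
have xJ : x \notin J by apply: nsh1; rewrite inE.
apply/fshattersP => C CJ.
have CxJ : C :\ x \subset J.
  by apply/subsetP => y; rewrite !inE => /andP[yx /(subsetP CJ)]; rewrite !inE (negbTE yx).
have [xC|xC] := boolP (x \in C).
  have [C' C'F C'J] := fshattersP _ _ shJ1 _ CxJ.
  move: C'F; rewrite inE => /andP[C'F xC']; exists C' => //.
  apply/setP => y; have /setP/(_ y) := C'J; rewrite !inE.
  by case: eqP => [-> _|_ //]; rewrite xC' xC.
have [C' C'F C'J] := fshattersP _ _ shJ0 _ CxJ.
move: C'F; rewrite inE => /andP[C'F xC']; exists C' => //.
apply/setP => y; have /setP/(_ y) := C'J; rewrite !inE.
by case: eqP => [-> _|_ //]; rewrite (negbTE xC') (negbTE xC).
Qed.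

(** A set with at most v elements is the range of a partial function from
    v points. *)
Lemma leq_card_small_sets (n v : nat) :
  #|[set J : {set 'I_n} | #|J| <= v]| <= n.+1 ^ v.
Proof.
pose im (f : {ffun 'I_v -> option 'I_n}) := [set i | Some i \in codom f].
have -> : n.+1 ^ v = #|[set: {ffun 'I_v -> option 'I_n}]|.
  by rewrite cardsT card_ffun card_option !card_ord.
apply: leq_trans (leq_imset_card im _); apply: subset_leq_card.
apply/subsetP => J; rewrite inE => Jv; apply/imsetP.
exists [ffun k : 'I_v => nth None [seq Some i | i <- enum J] k]; first by rewrite inE.
apply/setP => i; rewrite inE; apply/idP/codomP => [iJ|[k]].
  have ik : index i (enum J) < v.
    by apply: leq_trans Jv; rewrite cardE index_mem mem_enum.
  exists (Ordinal ik); rewrite ffunE /= (nth_map i) ?nth_index ?mem_enum//.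
  by rewrite index_mem mem_enum.
rewrite ffunE => Ek.
have [kJ|kJ] := ltnP k (size (enum J)); last by rewrite nth_default ?size_map in Ek.
by move: Ek; rewrite (nth_map i)// => -[->]; rewrite -mem_enum mem_nth.
Qed.

Lemma sauer_shelah (n v : nat) (F : {set {set 'I_n}}) :
  (forall J : {set _}, fshatters F J -> #|J| <= v) -> #|F| <= n.+1 ^ v.
Proof.
move=> Fv; apply: leq_trans (leq_card_small_sets n v).
apply: leq_trans (leq_card_fshatters F) _; apply: subset_leq_card.
by apply/subsetP => J; rewrite !inE => /Fv.
Qed.

From mathcomp Require Import all_classical all_reals all_analysis.
From mathcomp Require Import measurable_realfun.
From mathcomp Require Import ring lra.

Import Order.TTheory GRing.Theory Num.Theory.
Import numFieldNormedType.Exports.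

Local Open Scope classical_set_scope.
Local Open Scope ring_scope.
Local Open Scope ereal_scope.

(** * Traces of a VC class on finitely many points *)

(** The traces are recorded as sets of indices, because the points x_i may
    repeat. *)
Definition traces (T : Type) n (C : set (set T)) (x : 'I_n -> T) : {set {set 'I_n}} :=
  [set I : {set 'I_n} | `[< exists2 A, C A & forall i, (i \in I) <-> A (x i) >]]%SET.

Lemma card_traces (T : Type) n v (C : set (set T)) (x : 'I_n -> T) :
  vc_dimension C v -> (#|traces C x| <= n.+1 ^ v)%N.
Proof.
move=> [_ Cv]; apply: sauer_shelah => J /fshattersP shJ.
have trJ (I : {set 'I_n}) : I \subset J -> exists2 A, C A &
    forall i, i \in J -> ((i \in I) <-> A (x i)).
  move=> /shJ[I']; rewrite inE => /asboolP[A CA I'A] <-.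
  by exists A => // i iJ; rewrite inE iJ andbT; exact: I'A.
(* If the traces shatter J, then x is injective on J and the class shatters
   the points x_j, j in J. *)
apply: (Cv _ (range (fun k : 'I_#|J| => x (enum_val k)))).
  apply: card_eq_trans (card_esym (@card_II _)); apply: inj_card_eq => k l _ _ /= xkl.
  have [|A _ Akl] := trJ [set enum_val k]%SET.
    by rewrite finset.sub1set enum_valP.
  apply/esym/enum_val_inj/eqP; rewrite -finset.in_set1.
  by apply/(Akl _ (enum_valP l)); rewrite -xkl; apply/(Akl _ (enum_valP k)); rewrite finset.in_set1.
move=> B BF; have [|A CA AB] := trJ [set i in J | `[< B (x i) >]]%SET.
  by apply/fintype.subsetP => i; rewrite inE => /andP[].
exists A => //; apply/seteqP; split => [y [Ay [k _ ky]]|y By].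
  move: Ay; rewrite -ky => /(AB _ (enum_valP k)).
  by rewrite inE => /andP[_ /asboolP].
have [k _ ky] := BF _ By; split; last by exists k.
rewrite -ky; apply/(AB _ (enum_valP k)); rewrite inE enum_valP /=.
by apply/asboolP; rewrite ky.
Qed.

(** * Integrals determined by a generating family of events *)

Lemma measurable_preimageT d1 d2 (T1 : measurableType d1)
    (T2 : measurableType d2) (f : T1 -> T2) (C : set T2) :
  measurable_fun setT f -> measurable C -> measurable (f @^-1` C).
Proof. by move=> mf mC; rewrite -[X in measurable X]setTI; exact: mf. Qed.

Section integral_weight.
Context {R : realType} {dO : measure_display} {Omega : measurableType dO}
  (P : {measure set Omega -> \bar R})
  {dT : measure_display} {T : measurableType dT} (Z : Omega -> T)
  (mZ : measurable_fun setT Z).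
Implicit Types W : Omega -> R.
Import HBNNSimple.

Lemma integral_nnsfun_weight W (h : {nnsfun T >-> R}) :
  measurable_fun setT W -> (forall w, 0 <= W w)%R ->
  \int[P]_w (h (Z w) * W w)%:E =
  \sum_(r \in range h)
     r%:E * \int[P]_(w in Z @^-1` (h @^-1` [set r])) (W w)%:E.
Proof.
move=> mW W0.
have mZh r : measurable (Z @^-1` (h @^-1` [set r])).
  exact: measurable_preimageT.
transitivity (\int[P]_w \sum_(r \in range h)
    (r * (\1_(Z @^-1` (h @^-1` [set r])) w * W w))%:E).
  apply: eq_integral => w _; rewrite fsumEFin//; congr EFin.
  rewrite fimfunE mulrC mulr_fsumr; apply: eq_fsbigr => r _.
  by rewrite mulrC mulrA.
rewrite ge0_integral_fsum//.
- apply: eq_fsbigr => r /set_mem[t _ <-].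
  under eq_integral do rewrite EFinM.
  rewrite ge0_integralZl//; last 3 first.
  + apply/measurable_EFinP/measurable_funM => //; exact: measurable_indic.
  + by move=> w _; rewrite lee_fin mulr_ge0.
  + by rewrite lee_fin.
  congr (_ * _); rewrite [RHS]integral_mkcond; apply: eq_integral => w _.
  rewrite patchE indicE; case: ifPn => _; first by rewrite mul1r.
  by rewrite mul0r.
- move=> r; apply/measurable_EFinP/measurable_funM => //.
  apply: measurable_funM => //; exact: measurable_indic.
- move=> r w _; rewrite lee_fin mulrA mulr_ge0//.
  have := nnfun_muleindic_ge0 h r (Z w); by rewrite lee_fin.
Qed.

(** Taking out what is known: for simple f the identity is linearity, and the
    general f is a monotone limit. In the applications W2 is a version of the
    conditional expectation of W1 given Z; it is a constant when W1 is the
    indicator of an event independent of Z. *)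
Lemma eq_integral_weight W1 W2 (f : T -> R) :
  measurable_fun setT W1 -> (forall w, 0 <= W1 w)%R ->
  measurable_fun setT W2 -> (forall w, 0 <= W2 w)%R ->
  (forall C, measurable C -> \int[P]_(w in Z @^-1` C) (W1 w)%:E =
                             \int[P]_(w in Z @^-1` C) (W2 w)%:E) ->
  measurable_fun setT f -> (forall t, 0 <= f t)%R ->
  \int[P]_w (f (Z w) * W1 w)%:E = \int[P]_w (f (Z w) * W2 w)%:E.
Proof.
move=> mW1 W10 mW2 W20 W12 mf f0.
have mf' : measurable_fun setT (EFin \o f) by exact/measurable_EFinP.
pose f_ := nnsfun_approx measurableT mf'.
have approx W : measurable_fun setT W -> (forall w, 0 <= W w)%R ->
    \int[P]_w (f (Z w) * W w)%:E =
    limn (fun n => \int[P]_w (f_ n (Z w) * W w)%:E).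
  move=> mW W0; rewrite -monotone_convergence//.
  - apply: eq_integral => w _; apply/esym/cvg_lim => //.
    under eq_fun do rewrite EFinM.
    rewrite EFinM; apply: cvgeZr => //.
    by apply: cvg_nnsfun_approx => // t _; rewrite lee_fin.
  - move=> n; apply/measurable_EFinP/measurable_funM => //.
    exact: measurableT_comp.
  - by move=> n w _; rewrite lee_fin mulr_ge0.
  - move=> w _ m n mn; rewrite lee_fin ler_wpM2r//.
    exact/lefP/nd_nnsfun_approx.
rewrite approx// [RHS]approx//; congr (limn _); apply/funext => n.
rewrite !integral_nnsfun_weight//; apply: eq_fsbigr => r _.
by rewrite W12.
Qed.
End integral_weight.

Section pi_lambda_integral.
Context {R : realType} {dO : measure_display} {Omega : measurableType dO}
  (P : {measure set Omega -> \bar R})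
  {dT : measure_display} {T : measurableType dT} (Z : Omega -> T)
  (mZ : measurable_fun setT Z).
Implicit Types W : Omega -> R.

Lemma eq_integral_preimage (G : set (set T)) W1 W2 :
  @measurable _ T = <<s G >> -> setI_closed G -> G setT ->
  measurable_fun setT W1 -> (forall w, 0 <= W1 w)%R ->
  measurable_fun setT W2 -> (forall w, 0 <= W2 w)%R ->
  \int[P]_w (W2 w)%:E < +oo ->
  (forall C, G C -> \int[P]_(w in Z @^-1` C) (W1 w)%:E =
                    \int[P]_(w in Z @^-1` C) (W2 w)%:E) ->
  forall C, measurable C -> \int[P]_(w in Z @^-1` C) (W1 w)%:E =
                            \int[P]_(w in Z @^-1` C) (W2 w)%:E.
Proof.
move=> TG GI GT mW1 W10 mW2 W20 W2oo W12 C; rewrite TG; move: C.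
have mZC C : measurable C -> measurable (Z @^-1` C).
  exact: measurable_preimageT.
have mW W (D : set Omega) : measurable_fun setT W ->
    measurable_fun D (EFin \o W).
  by move=> mW; apply/measurable_EFinP/measurable_funTS.
have split_setC W C : measurable C -> measurable_fun setT W ->
    (forall w, 0 <= W w)%R ->
    \int[P]_w (W w)%:E = \int[P]_(w in Z @^-1` C) (W w)%:E +
                         \int[P]_(w in Z @^-1` (~` C)) (W w)%:E.
  move=> mC mW' W0; rewrite -ge0_integral_setU//.
  - by rewrite -preimage_setU setUv preimage_setT.
  - exact: mZC.
  - by apply: mZC; exact: measurableC.
  - exact: mW.
  - by move=> w _; rewrite lee_fin.
  - by rewrite disj_set2E -preimage_setI setICr preimage_set0.
have fin W C : measurable C -> measurable_fun setT W ->
    (forall w, 0 <= W w)%R -> \int[P]_w (W w)%:E < +oo ->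
    \int[P]_(w in Z @^-1` C) (W w)%:E \is a fin_num.
  move=> mC mW' W0 Woo; rewrite ge0_fin_numE; last first.
    by apply: integral_ge0 => w _; rewrite lee_fin.
  apply: le_lt_trans Woo; apply: ge0_subset_integral => //.
  - exact: mZC.
  - exact: mW.
  - by move=> w _; rewrite lee_fin.
have W12T := W12 _ GT; rewrite preimage_setT in W12T.
apply: (dynkin_induction TG GI) => //.
- move=> C mC W12C; move: W12T; rewrite (split_setC W1 C)// (split_setC W2 C)//.
  rewrite W12C; have := fin W2 C mC mW2 W20 W2oo.
  by move: (integral _ _ _) (integral _ _ _) (integral _ _ _) =>
    [x| |] [a| |] [b| |] //= _ [] /addrI ->.
- move=> F mF tF W12F.
  have tZF : trivIset setT (fun k => Z @^-1` F k).
    by move=> k l _ _ [w [Fk Fl]]; apply: tF => //; exists (Z w).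
  rewrite preimage_bigcup !ge0_integral_bigcup//.
  + by apply: eq_eseriesr => k _; exact: W12F.
  + by move=> k; exact: mZC.
  + exact: mW.
  + by move=> w _; rewrite lee_fin.
  + by move=> k; exact: mZC.
  + exact: mW.
  + by move=> w _; rewrite lee_fin.
Qed.
End pi_lambda_integral.

Definition boxes d (T : measurableType d) n : set (set (n.-tuple T)) :=
  [set [set s | forall i, C i (tnth s i)] |
    C in [set C : 'I_n -> set T | forall i, measurable (C i)]].

Lemma setI_closed_boxes d (T : measurableType d) n : setI_closed (@boxes d T n).
Proof.
move=> _ _ [C mC <-] [D mD <-]; exists (fun i => C i `&` D i).
  by move=> i; exact: measurableI.
by apply/seteqP; split => s /=; [move=> CD; split => i; case: (CD i)|
  move=> [Cs Ds] i; split].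
Qed.

Lemma boxesT d (T : measurableType d) n : boxes [set: n.-tuple T].
Proof. by exists (fun=> setT) => //; apply/seteqP; split. Qed.

Lemma measurable_box d (T : measurableType d) n (C : 'I_n -> set T) :
  (forall i, measurable (C i)) ->
  measurable [set s : n.-tuple T | forall i, C i (tnth s i)].
Proof.
move=> mC; rewrite (_ : [set s | _] =
    \big[setI/setT]_(i < n) ((fun s => tnth s i) @^-1` C i)).
  apply: bigsetI_measurable => i _; apply: measurable_preimageT => //.
  exact: measurable_tnth.
apply/seteqP; split => s /=.
  by move=> sC; rewrite -bigcap_seq => i _; exact: sC.
by rewrite -bigcap_seq => sC i; apply: (sC i) => /=; rewrite mem_index_enum.
Qed.

Lemma measurable_tuple_boxes d (T : measurableType d) n :
  @measurable _ (n.-tuple T) = <<s @boxes d T n >>.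
Proof.
apply/seteqP; split; last first.
  apply: smallest_sub; first exact: sigma_algebra_measurable.
  by move=> _ [C mC <-]; exact: measurable_box.
apply: smallest_sub; first exact: smallest_sigma_algebra.
move=> A; rewrite -bigcup_seq => -[i _ [C mC <-]].
apply: sub_sigma_algebra; exists (fun j => if j == i then C else setT).
  by move=> j; case: ifP.
apply/seteqP; split => s /=; first by move=> /(_ i); rewrite eqxx.
by move=> [_ Cs] j; case: eqP => [->|].
Qed.

Lemma ge0_integral_same_law (R : realType) d1 d2 (T1 : measurableType d1)
    (T2 : measurableType d2) (mu : {measure set T1 -> \bar R})
    (Z1 Z2 : T1 -> T2) (f : T2 -> R) :
  measurable_fun setT Z1 -> measurable_fun setT Z2 ->
  (forall C, measurable C -> mu (Z1 @^-1` C) = mu (Z2 @^-1` C)) ->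
  measurable_fun setT f -> (forall t, 0 <= f t)%R ->
  \int[mu]_w (f (Z1 w))%:E = \int[mu]_w (f (Z2 w))%:E.
Proof.
move=> mZ1 mZ2 Z12 mf f0; have mf' : measurable_fun setT (EFin \o f).
  exact/measurable_EFinP.
have f0' : {in setT, forall t, 0 <= (EFin \o f) t}.
  by move=> t _; rewrite lee_fin.
have := ge0_integral_pushforward mZ1 mu measurableT mf' f0'.
have := ge0_integral_pushforward mZ2 mu measurableT mf' f0'.
rewrite !preimage_setT => /= <- <-.
pose mu1 := measure_function_pushforward__canonical__measure_function_Measure mu mZ1.
pose mu2 := measure_function_pushforward__canonical__measure_function_Measure mu mZ2.
apply: (@eq_measure_integral _ _ _ setT mu2 mu1) => A mA _.
exact: Z12.
Qed.

(** * Independence and conditional exponential moments *)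

Section independence.
Context {R : realType} {d n : nat} {dO : measure_display}
  {Omega : measurableType dO} (P : probability Omega R).
Variables (X : {RV P >-> d.-tuple R}) (Y : {RV P >-> R}).
Variables (X_ : 'I_n -> {RV P >-> d.-tuple R}) (Y_ : 'I_n -> {RV P >-> R}).
Hypothesis hiid : iid_copies X_ Y_ X Y.

Let Z w := (X w, Y w).
Let Z_ i w := (X_ i w, Y_ i w).

Let mZ : measurable_fun setT Z.
Proof. exact: measurable_fun_pair. Qed.

Let mZ_ i : measurable_fun setT (Z_ i).
Proof. exact: measurable_fun_pair. Qed.

(** The product rule for events extends to one observation that enters through
    a function: the indicator of the event about the others is, given that
    observation, a constant. *)
Lemma integral_copy_on_others i (C : 'I_n -> set (d.-tuple R * R))
    (phi : d.-tuple R * R -> R) :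
  (forall j, measurable (C j)) ->
  measurable_fun setT phi -> (forall z, 0 <= phi z)%R ->
  \int[P]_(w in [set w | forall j, j != i -> C j (Z_ j w)]) (phi (Z_ i w))%:E =
  P [set w | forall j, j != i -> C j (Z_ j w)] * \int[P]_w (phi (Z w))%:E.
Proof.
move=> mC mphi phi0; set E := [set w | _].
pose CD D j := if j == i then D else C j.
have mCD D j : measurable D -> measurable (CD D j) by rewrite /CD; case: ifP.
have ECD D : E `&` Z_ i @^-1` D = [set w | forall j, CD D j (Z_ j w)].
  apply/seteqP; split => w /=.
    by move=> [Ew Dw] j; rewrite /CD; case: eqP => [->//|/eqP ji]; exact: Ew.
  move=> CDw; split; last by have := CDw i; rewrite /CD eqxx.
  by move=> j /negbTE ji; have := CDw j; rewrite /CD ji.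
have PECD D : measurable D -> P (E `&` Z_ i @^-1` D) =
    P (Z_ i @^-1` D) * \prod_(j < n | j != i) P [set w | C j (Z_ j w)].
  move=> mD; rewrite ECD hiid.2; last by move=> j; exact: mCD.
  rewrite (bigD1 i)//=; congr (_ * _); first by rewrite /CD eqxx.
  by apply: eq_bigr => j /negbTE ji; rewrite /CD ji.
have PE : P E = \prod_(j < n | j != i) P [set w | C j (Z_ j w)].
  by rewrite -[E]setIT -(preimage_setT (Z_ i)) PECD// preimage_setT probability_setT mul1e.
have mE : measurable E.
  rewrite -[E]setIT -(preimage_setT (Z_ i)) ECD.
  rewrite [X in measurable X](_ : _ =
      \big[setI/setT]_(j < n) ((Z_ j) @^-1` (CD setT j))).
    apply: bigsetI_measurable => j _; apply: measurable_preimageT => //.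
    exact: mCD.
  by rewrite -bigcap_seq; apply/seteqP; split => w /= Cw j;
    [move=> _; exact: Cw|apply: (Cw j); rewrite /= mem_index_enum].
transitivity (\int[P]_w (phi (Z_ i w) * \1_E w)%:E).
  rewrite integral_mkcond; apply: eq_integral => w _.
  by rewrite patchE indicE; case: ifPn => _; rewrite ?mulr1 ?mulr0.
rewrite (@eq_integral_weight _ _ _ P _ _ (Z_ i) (mZ_ i) _ (cst (fine (P E))))//=.
- under eq_integral do rewrite EFinM muleC.
  rewrite ge0_integralZl//; last 3 first.
  + exact/measurable_EFinP/measurableT_comp.
  + by move=> w _; rewrite lee_fin.
  + by rewrite lee_fin fine_ge0.
  rewrite fineK ?fin_num_measure//; congr (_ * _).
  by apply: ge0_integral_same_law => // D mD; exact: hiid.1.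
- by move=> w; rewrite fine_ge0.
- move=> D mD; rewrite integral_indic//; last exact: measurable_preimageT.
  rewrite integral_cst ?fineK ?fin_num_measure//; last exact: measurable_preimageT.
  by have := PECD D mD; rewrite -PE muleC.
Qed.
End independence.

Section clipped_mgf.
Context {R : realType} {d : nat} {dO : measure_display}
  {Omega : measurableType dO} (P : probability Omega R).
Variables (X : {RV P >-> d.-tuple R}) (eps : Omega -> R) (sigma : R).

(** A conditional expectation is only determined almost surely; clipping a
    version of it makes the bounds hold at every point. *)
Lemma clipped_cond_mgf (t : R) : cond_subgaussian X eps sigma ->
  exists h : d.-tuple R -> R,
  [/\ measurable_fun setT h,
      forall x, (0 <= h x <= expR (sigma ^+ 2 * t ^+ 2 / 2))%R &
      forall B, measurable B ->
        \int[P]_(w in X @^-1` B) (expR (t * eps w))%:E =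
        \int[P]_(w in X @^-1` B) (h (X w))%:E].
Proof.
move=> [_ /(_ t)[h [ie mh ih he] hc]].
set c := expR _ in hc *.
have mX B : measurable B -> measurable (X @^-1` B).
  exact: measurable_preimageT.
pose N := [set x | (h x < 0)%R].
have mN : measurable N.
  rewrite (_ : N = h @^-1` `]-oo, 0%R[%classic).
    exact: measurable_preimageT.
  by apply/seteqP; split => x /=; rewrite in_itv.
(* The integral of the version over the event where it is negative is also
   that of an exponential. *)
have aeN : {ae P, forall w, (0 <= h (X w))%R}.
  have mhX : measurable_fun (X @^-1` N) (fun w => (h (X w))%:E).
    by apply/measurable_EFinP/measurable_funTS/measurableT_comp.
  have : ae_eq P (X @^-1` N) (fun w => (h (X w))%:E) (cst 0).
    apply/ae_eq_integral_abs => //; first exact: mX.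
    apply/eqP; rewrite eq_le; apply/andP; split; last exact: integral_ge0.
    rewrite (eq_integral (fun w => - (h (X w))%:E)); last first.
      by move=> w /set_mem /= Nw; rewrite ltr0_norm.
    have hN : \int[P]_(w in X @^-1` N) (h (X w))%:E =
        - \int[P]_(w in X @^-1` N) - (h (X w))%:E.
      rewrite -integral_ge0N; first by apply: eq_integral => w _; rewrite oppeK.
      by move=> w /= Nw; rewrite lee_fin oppr_ge0 ltW.
    rewrite -[leLHS]oppeK -hN.
    rewrite -he// oppe_le0; apply: integral_ge0 => w _.
    by rewrite lee_fin expR_ge0.
  apply: filterS => w /= hw; rewrite leNgt; apply/negP => Nw.
  by have [h0] := hw Nw; move: Nw; rewrite h0 ltxx.
exists (fun x => Num.min (Num.max (h x) 0) c)%R; split.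
- apply: measurable_minr => //; exact: measurable_maxr.
- by move=> x; rewrite ge_min lexx orbT andbT le_min le_max lexx orbT expR_ge0.
- move=> B mB; rewrite he//; apply: ae_eq_integral; first exact: mX.
  + by apply/measurable_EFinP/measurable_funTS/measurableT_comp.
  + apply/measurable_EFinP/measurable_funTS.
    apply: measurable_minr => //; apply: measurable_maxr => //.
    exact: measurableT_comp.
  + apply: filterS2 aeN hc => w h0 hle _; congr EFin.
    by rewrite max_l// min_l.
Qed.
End clipped_mgf.

(** * Sub-Gaussian tails given the design *)

Section tuple_maps.
Context {R : realType} {d n : nat}.
Local Notation point := (d.-tuple R * R)%type.
Implicit Types (s : n.-tuple point) (g : d.-tuple R -> R) (I : seq 'I_n).

Definition design s : n.-tuple (d.-tuple R) := [tuple (tnth s i).1 | i < n].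

Definition erase_response i s : n.-tuple point :=
  [tuple if j == i then ((tnth s j).1, 0%R) else tnth s j | j < n].

Definition residual_sum (g : d.-tuple R -> R) (I : seq 'I_n) s : R :=
  (\sum_(i <- I) ((tnth s i).2 - g (tnth s i).1))%R.

Lemma measurable_design : measurable_fun setT design.
Proof.
apply/measurable_fun_tnthP => i; rewrite (_ : _ \o _ = fun s => (tnth s i).1).
  by apply: measurableT_comp => //; exact: measurable_tnth.
by apply/funext => s /=; rewrite tnth_mktuple.
Qed.

Lemma measurable_erase_response i : measurable_fun setT (erase_response i).
Proof.
apply/measurable_fun_tnthP => j; have [ji|/negbTE ji] := eqVneq j i.
  rewrite (_ : _ \o _ = fun s => ((tnth s j).1, 0%R)).
    apply: measurable_fun_pair => //.
    by apply: measurableT_comp => //; exact: measurable_tnth.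
  by apply/funext => s /=; rewrite tnth_mktuple ji eqxx.
rewrite (_ : _ \o _ = fun s => tnth s j); first exact: measurable_tnth.
by apply/funext => s /=; rewrite tnth_mktuple ji.
Qed.

Lemma measurable_residual g i : measurable_fun setT g ->
  measurable_fun setT (fun s => (tnth s i).2 - g (tnth s i).1)%R.
Proof.
move=> mg; apply: measurable_funB.
  by apply: measurableT_comp => //; exact: measurable_tnth.
apply: measurableT_comp => //; apply: measurableT_comp => //.
exact: measurable_tnth.
Qed.

Lemma measurable_residual_sum g I : measurable_fun setT g ->
  measurable_fun setT (residual_sum g I).
Proof.
by move=> mg; apply: measurable_sum => i; exact: measurable_residual.
Qed.

Lemma design_erase_response i s : design (erase_response i s) = design s.
Proof.
apply: eq_from_tnth => j; rewrite !tnth_mktuple.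
by case: eqP.
Qed.

Lemma residual_sum_erase_response g I i s : i \notin I ->
  residual_sum g I (erase_response i s) = residual_sum g I s.
Proof.
move=> iI; apply: eq_big_seq => j jI; rewrite tnth_mktuple.
by case: eqP => // ji; rewrite -ji jI in iI.
Qed.
End tuple_maps.

Section chernoff.
Context {R : realType} {d n : nat} {dO : measure_display}
  {Omega : measurableType dO} (P : probability Omega R).
Variables (X : {RV P >-> d.-tuple R}) (Y : {RV P >-> R}).
Variables (X_ : 'I_n -> {RV P >-> d.-tuple R}) (Y_ : 'I_n -> {RV P >-> R}).
Variables (g : d.-tuple R -> R) (sigma : R).
Hypothesis hiid : iid_copies X_ Y_ X Y.
Hypothesis mg : measurable_fun setT g.
Hypothesis hsub : cond_subgaussian X (noise X Y g) sigma.

Local Notation sXY := (sample X_ Y_).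
Let msXY : measurable_fun setT sXY := measurable_sample X_ Y_.

Let mres i : measurable_fun setT (fun w => Y_ i w - g (X_ i w))%R.
Proof. by apply: measurable_funB => //; exact: measurableT_comp. Qed.

(** Given the sample without its i-th response, exp(t (Y_i - g(X_i))) has the
    conditional mean h(X_i). Both sides are finite measures of G, so it is
    enough to compare them on boxes, where independence separates the i-th
    observation from the others. *)
Lemma integral_exp_residual (t : R) i (h : d.-tuple R -> R) (c : R) :
  measurable_fun setT h -> (forall x, 0 <= h x <= c)%R ->
  (forall B, measurable B ->
     \int[P]_(w in X @^-1` B) (expR (t * noise X Y g w))%:E =
     \int[P]_(w in X @^-1` B) (h (X w))%:E) ->
  forall G, measurable G ->
    \int[P]_(w in (erase_response i \o sXY) @^-1` G)
       (expR (t * (Y_ i w - g (X_ i w))))%:E =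
    \int[P]_(w in (erase_response i \o sXY) @^-1` G) (h (X_ i w))%:E.
Proof.
move=> mh h0c hE.
have mexp : measurable_fun setT
    (fun z : d.-tuple R * R => expR (t * (z.2 - g z.1)))%R.
  apply: measurableT_comp => //; apply: measurable_funM => //.
  by apply: measurable_funB => //; exact: measurableT_comp.
have mhX : measurable_fun setT (fun w => h (X_ i w)) by exact: measurableT_comp.
apply: (@eq_integral_preimage _ _ _ P _ _ (erase_response i \o sXY) _
  (@boxes _ (d.-tuple R * R)%type n)) => //.
- by apply: measurableT_comp => //; exact: measurable_erase_response.
- exact: measurable_tuple_boxes.
- exact: setI_closed_boxes.
- exact: boxesT.
- by apply: measurableT_comp => //; exact: measurable_funM.
- by move=> w; have /andP[] := h0c (X_ i w).
- apply: (@le_lt_trans _ _ (\int[P]_w (cst c%:E) w)).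
    apply: ge0_le_integral => //.
    + by move=> w _; rewrite lee_fin; have /andP[] := h0c (X_ i w).
    + exact/measurable_EFinP.
    + by move=> w _; rewrite lee_fin; have /andP[] := h0c (X_ i w).
  by rewrite integral_cst// [X in _ * X](probability_setT P) mule1 ltry.
move=> _ [C mC <-].
pose A := [set x | C i (x, 0%R)].
have mA : measurable A.
  rewrite (_ : A = (fun x => (x, 0%R)) @^-1` C i)//.
  by apply: measurable_preimageT => //; exact: measurable_fun_pair.
pose E := [set w | forall j, j != i -> C j (X_ j w, Y_ j w)].
have -> : (erase_response i \o sXY) @^-1` [set s | forall j, C j (tnth s j)] =
    E `&` X_ i @^-1` A.
  apply/seteqP; split => w /=.
    move=> Cw; split => [j /negbTE ji|].
      by have := Cw j; rewrite !tnth_mktuple ji.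
    by have := Cw i; rewrite !tnth_mktuple eqxx.
  move=> [Ew Aw] j; rewrite !tnth_mktuple; case: eqP => [->//|/eqP].
  exact: Ew.
have key (phi : d.-tuple R * R -> R) :
    measurable_fun setT phi -> (forall z, 0 <= phi z)%R ->
    \int[P]_(w in E `&` X_ i @^-1` A) (phi (X_ i w, Y_ i w))%:E =
    P E * \int[P]_(w in X @^-1` A) (phi (X w, Y w))%:E.
  move=> mphi phi0; rewrite integral_mkcondr [in RHS]integral_mkcond.
  pose psi z := (\1_A z.1 * phi z)%R.
  rewrite (eq_integral (fun w => (psi (X_ i w, Y_ i w))%:E)); last first.
    move=> w _; rewrite patchE /psi/= indicE.
    have -> : (w \in X_ i @^-1` A) = (X_ i w \in A) by [].
    by case: ifP => _; rewrite ?mul1r ?mul0r.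
  rewrite (integral_copy_on_others hiid)//.
  - congr (_ * _); apply: eq_integral => w _; rewrite patchE /psi/= indicE.
    have -> : (w \in X @^-1` A) = (X w \in A) by [].
    by case: ifP => _; rewrite ?mul1r ?mul0r.
  - by apply: measurable_funM => //; exact: measurableT_comp.
  - by move=> z; rewrite mulr_ge0.
have := key (fun z => expR (t * (z.2 - g z.1))%R) mexp.
move=> /= -> ; last by move=> z; rewrite expR_ge0.
rewrite (key (fun z => h z.1))//; last 2 first.
- exact: measurableT_comp.
- by move=> z; have /andP[] := h0c z.1.
by rewrite (hE A mA).
Qed.

Lemma measurable_design_event M : measurable M ->
  measurable [set w | M (design (sXY w))].
Proof.
move=> mM.
have mMd : measurable (design @^-1` M : set (n.-tuple (d.-tuple R * R))).
  by apply: measurable_preimageT => //; exact: measurable_design.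
exact: (measurable_preimageT msXY mMd).
Qed.

(** One residual is integrated out at a time: the remaining factor does not see
    the response that is being erased. *)
Lemma exp_residual_sum_le (t : R) (I : seq 'I_n) M : uniq I -> measurable M ->
  \int[P]_w (\1_M (design (sXY w)) * expR (t * residual_sum g I (sXY w)))%:E <=
  (expR (sigma ^+ 2 * t ^+ 2 / 2 * (size I)%:R))%:E *
    P [set w | M (design (sXY w))].
Proof.
have [h [mh h0c hE]] := clipped_cond_mgf t hsub.
set c := expR _ in h0c.
move=> uI mM; have mMw := measurable_design_event mM.
elim: I uI => [_|i I IH /andP[iI uI]].
  rewrite /= mulr0 expR0 mul1e.
  under eq_integral do rewrite /residual_sum big_nil mulr0 expR0 mulr1.
  have /= := @integral_indic _ _ _ P setT measurableT _ mMw.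
  by rewrite setIT => <-.
pose f (s : n.-tuple (d.-tuple R * R)) :=
  (\1_M (design s) * expR (t * residual_sum g I s))%R.
have mf : measurable_fun setT f.
  apply: measurable_funM; first exact: measurableT_comp measurable_design.
  apply: measurableT_comp => //; apply: measurable_funM => //.
  exact: measurable_residual_sum.
have f0 s : (0 <= f s)%R by rewrite mulr_ge0// expR_ge0.
have f_erase s : f (erase_response i s) = f s.
  by rewrite /f design_erase_response residual_sum_erase_response.
have mexp : measurable_fun setT (fun w => expR (t * (Y_ i w - g (X_ i w)))%R).
  by apply: measurableT_comp => //; exact: measurable_funM.
have mhX : measurable_fun setT (fun w => h (X_ i w)) by exact: measurableT_comp.
have mfs : measurable_fun setT (fun w => f (sXY w)) by exact: measurableT_comp.
rewrite (eq_integral (fun w => (f (erase_response i (sXY w)) *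
    expR (t * (Y_ i w - g (X_ i w))))%:E)); last first.
  move=> w _; rewrite f_erase /f -mulrA -expRD -mulrDr; congr (_ * expR (t * _))%:E.
  by rewrite /residual_sum big_cons tnth_mktuple addrC.
have -> : \int[P]_w (f (erase_response i (sXY w)) *
    expR (t * (Y_ i w - g (X_ i w))))%:E =
    \int[P]_w (f (erase_response i (sXY w)) * h (X_ i w))%:E.
  apply: (@eq_integral_weight _ _ _ P _ _ (erase_response i \o sXY)) => //.
  - by apply: measurableT_comp => //; exact: measurable_erase_response.
  - by move=> w; have /andP[] := h0c (X_ i w).
  - exact: integral_exp_residual mh h0c hE.
apply: (@le_trans _ _ (\int[P]_w (c%:E * (f (sXY w))%:E))).
  apply: ge0_le_integral => //.
  - by move=> w _; rewrite lee_fin mulr_ge0//; have /andP[] := h0c (X_ i w).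
  - apply/measurable_EFinP/measurable_funM => //.
    by under eq_fun do rewrite f_erase.
  - by apply/measurable_EFinP/measurable_funM.
  - move=> w _; rewrite f_erase lee_fin mulrC ler_wpM2r//.
    by have /andP[] := h0c (X_ i w).
rewrite ge0_integralZl//; last 3 first.
- exact/measurable_EFinP.
- by move=> w _; rewrite lee_fin.
- by rewrite lee_fin expR_ge0.
have -> : ((size (i :: I))%:R = (size I)%:R + 1 :> R)%R by rewrite natr1.
rewrite mulrDr mulr1 expRD -/c mulrC EFinM -muleA.
by rewrite lee_wpmul2l ?lee_fin ?expR_ge0//; exact: IH.
Qed.

Let mrs I : measurable_fun setT (fun w => residual_sum g I (sXY w)).
Proof. by apply: measurableT_comp => //; exact: measurable_residual_sum. Qed.

Let mtail (t a : R) I : measurable [set w | a <= t * residual_sum g I (sXY w)]%R.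
Proof.
rewrite (_ : [set w | _] =
    (fun w => t * residual_sum g I (sXY w))%R @^-1` `[a, +oo[%classic).
  by apply: measurable_preimageT => //; exact: measurable_funM.
by apply/seteqP; split => w /=; rewrite in_itv/= andbT.
Qed.

Let mtail_lt (t a : R) I : measurable [set w | a < t * residual_sum g I (sXY w)]%R.
Proof.
rewrite (_ : [set w | _] =
    (fun w => t * residual_sum g I (sXY w))%R @^-1` `]a, +oo[%classic).
  by apply: measurable_preimageT => //; exact: measurable_funM.
by apply/seteqP; split => w /=; rewrite in_itv/= andbT.
Qed.

Lemma chernoff_bound (t a : R) I M : uniq I -> measurable M ->
  P [set w | M (design (sXY w)) /\ (a <= t * residual_sum g I (sXY w))%R] <=
  (expR (sigma ^+ 2 * t ^+ 2 / 2 * (size I)%:R - a))%:E *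
    P [set w | M (design (sXY w))].
Proof.
move=> uI mM; set B := [set w | _ /\ _].
have mB : measurable B.
  by apply: measurableI; [exact: measurable_design_event|exact: mtail].
rewrite addrC expRD EFinM -muleA expRN lee_pdivlMl ?expR_gt0//.
apply: le_trans (exp_residual_sum_le t uI mM).
have -> : P B = \int[P]_w (\1_B w)%:E.
  by have /= := @integral_indic _ _ _ P setT measurableT _ mB; rewrite setIT.
rewrite -ge0_integralZl//; last first.
  exact/measurable_EFinP.
have mMs : measurable_fun setT (fun w => \1_M (design (sXY w)) : R).
  apply: measurableT_comp; first exact: measurable_indic.
  by apply: measurableT_comp => //; exact: measurable_design.
apply: ge0_le_integral => //.
- under eq_fun do rewrite -EFinM.
  by apply/measurable_EFinP/measurable_funM.
- apply/measurable_EFinP/measurable_funM => //; apply: measurableT_comp => //.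
  exact: measurable_funM.
- move=> w _; rewrite -EFinM lee_fin !indicE.
  have [|_] := boolP (w \in B); last by rewrite mulr0 mulr_ge0 ?expR_ge0.
  by rewrite inE => -[Mw aw]; rewrite mulr1 mem_set// mul1r ler_expR.
Qed.

(** The sign t is 1 or -1. The minimizer s / v of the Chernoff exponent, where
    v is the variance proxy of the sum, is available for v > 0; for v = 0 the
    exponent is linear and every positive level has probability zero. *)
Lemma subgaussian_half_tail (t L : R) I M : (t ^+ 2 = 1)%R -> (0 <= L)%R ->
  uniq I -> measurable M ->
  P [set w | M (design (sXY w)) /\
    (Num.sqrt (2 * sigma ^+ 2 * L * (size I)%:R) <
     t * residual_sum g I (sXY w))%R] <=
  (expR (- L))%:E * P [set w | M (design (sXY w))].
Proof.
move=> t1 L0 uI mM; set s := Num.sqrt _.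
set v := (sigma ^+ 2 * (size I)%:R)%R.
have v0 : (0 <= v)%R by rewrite mulr_ge0 ?sqr_ge0.
have s2 : (s ^+ 2 = 2 * L * v)%R.
  rewrite sqr_sqrtr; first by rewrite /v; ring.
  by do 3?[apply: mulr_ge0 => //]; exact: sqr_ge0.
have mD := measurable_design_event mM.
have chern (l a : R) : (0 <= l)%R ->
    P [set w | M (design (sXY w)) /\ (a <= t * residual_sum g I (sXY w))%R] <=
    (expR (l ^+ 2 * v / 2 - l * a))%:E * P [set w | M (design (sXY w))].
  move=> l0; have := chernoff_bound (l * t) (l * a) uI mM.
  rewrite (_ : sigma ^+ 2 * (l * t) ^+ 2 / 2 * (size I)%:R = l ^+ 2 * v / 2)%R; last first.
    by rewrite exprMn t1 /v; field.
  apply: le_trans; apply: le_measure; rewrite ?inE.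
  - by apply: measurableI => //; exact: mtail.
  - by apply: measurableI => //; exact: mtail.
  - by move=> w [Mw aw]; split=> //; rewrite -mulrA ler_wpM2l.
have [v_eq0|vN0] := eqVneq v 0%R.
  have s0 : s = 0%R by apply/eqP; rewrite -sqrf_eq0 s2 v_eq0 mulr0.
  rewrite s0; set Q := (X in P X <= _).
  have null m : P [set w | M (design (sXY w)) /\
      (m.+1%:R^-1 <= t * residual_sum g I (sXY w))%R] = 0.
    apply/eqP; rewrite eq_le measure_ge0 andbT; apply/lee_addgt0Pr => e e0; rewrite add0e.
    pose k := (Num.max 0 (- ln e))%R.
    have k0 : (0 <= k)%R by rewrite le_max lexx.
    apply: le_trans (chern (m.+1%:R * k)%R (m.+1%:R^-1)%R _) _.
      by rewrite mulr_ge0.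
    rewrite v_eq0 mulr0 mul0r add0r mulrAC divff// mul1r.
    apply: (@le_trans _ _ (expR (- k))%:E).
      by rewrite -[leRHS]mule1 lee_wpmul2l ?lee_fin ?expR_ge0// probability_le1.
    by rewrite lee_fin -[leRHS]lnK ?posrE// ler_expR lerNl le_max lexx orbT.
  have -> : P Q = 0.
    apply/eqP; rewrite eq_le measure_ge0 andbT.
    rewrite (_ : Q = \bigcup_m [set w | M (design (sXY w)) /\
      (m.+1%:R^-1 <= t * residual_sum g I (sXY w))%R]).
      apply: le_trans (measure_sigma_subadditive _ _ _ (@subset_refl _ _)) _.
      - by move=> m; apply: measurableI => //; exact: mtail.
      - by apply: bigcupT_measurable => m; apply: measurableI => //; exact: mtail.
      - by rewrite eseries0// => m _ _; exact: null.
    apply/seteqP; split => w.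
      move=> [Mw tw]; exists (Num.bound (t * residual_sum g I (sXY w))^-1) => //.
      split => //=; rewrite invf_ple ?posrE//.
      apply: (le_trans (ltW (archi_boundP _))).
        by rewrite invr_ge0 ltW.
      by rewrite ler_nat.
    by move=> [m _ [Mw mw]]; split=> //; apply: lt_le_trans mw; rewrite invr_gt0.
  by rewrite mule_ge0// lee_fin expR_ge0.
have v_gt0 : (0 < v)%R by rewrite lt_neqAle eq_sym vN0.
have -> : (- L = (s / v) ^+ 2 * v / 2 - (s / v) * s)%R.
  by rewrite (_ : _ - _ = - (s ^+ 2) / (2 * v))%R; [rewrite s2; field|field].
apply: le_trans (chern (s / v)%R s _); last by rewrite divr_ge0// sqrtr_ge0.
apply: le_measure; rewrite ?inE.
- by apply: measurableI => //; exact: mtail_lt.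
- by apply: measurableI => //; exact: mtail.
- by move=> w [Mw sw]; split=> //; exact: ltW.
Qed.

Lemma subgaussian_tail (L : R) I M : (0 <= L)%R -> uniq I -> measurable M ->
  P [set w | M (design (sXY w)) /\
    (Num.sqrt (2 * sigma ^+ 2 * L * (size I)%:R) <
     `|residual_sum g I (sXY w)|)%R] <=
  (2 * expR (- L))%:E * P [set w | M (design (sXY w))].
Proof.
move=> L0 uI mM; set s := Num.sqrt _.
have mhalf (t : R) : measurable [set w | M (design (sXY w)) /\
    (s < t * residual_sum g I (sXY w))%R].
  by apply: measurableI; [exact: measurable_design_event|exact: mtail_lt].
rewrite mulr2n mulrDl mul1r EFinD ge0_muleDl ?lee_fin ?expR_ge0//.
have t1 : (1 ^+ 2 = 1 :> R)%R by rewrite expr1n.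
have tN1 : ((-1) ^+ 2 = 1 :> R)%R by rewrite sqrrN expr1n.
apply: le_trans (leeD (subgaussian_half_tail t1 L0 uI mM)
  (subgaussian_half_tail tN1 L0 uI mM)).
rewrite -/s; apply: le_trans (measureU2 _ (mhalf _) (mhalf _)).
rewrite le_eqVlt; apply/orP; left; apply/eqP; congr (P _).
apply/seteqP; split => w /=; rewrite ltr_normr mul1r mulN1r.
  by move=> [Mw /orP[]]; [left|right].
by move=> [[Mw sw]|[Mw sw]]; split=> //; rewrite sw ?orbT.
Qed.
End chernoff.

(** * Inner approximation by sets with a measurable projection *)

Lemma decreasing_compacts_meet (K : topologicalType) (C : (set K)^nat) :
  hausdorff_space K -> (forall j, compact (C j)) -> (forall j, C j !=set0) ->
  (forall i j, (i <= j)%N -> C j `<=` C i) -> \bigcap_j C j !=set0.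
Proof.
move=> hK cC C0 dC; have /choice[z Cz] : forall j, exists z, C j z.
  by move=> j; have [z] := C0 j; exists z.
have FC j : (z @ \oo) (C j).
  by exists j => // i /= ji; apply: (dC _ _ ji); exact: Cz.
have [p [_ clp]] := cC 0%N (z @ \oo) _ (FC 0%N).
exists p => j _; apply: (compact_closed hK (cC j)) => B nB.
by have := clp _ _ (FC j) nB.
Qed.

Section inner_approximation.
Context {R : realType} {dS dT : measure_display} {S : measurableType dS}
  {T : measurableType dT} {K : topologicalType} (x : S -> T) (y : S -> K)
  (mu : {finite_measure set S -> \bar R}).
Hypotheses (hK : hausdorff_space K) (mx : measurable_fun setT x)
  (xy_surj : forall t z, exists s, x s = t /\ y s = z).
Implicit Types A B D : set S.

(** The section of A over t is the compact set C (k t). The index k takes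
    countably many values, measurably, which makes the set of the t with a
    nonempty section measurable. *)
Definition compact_fibred A := measurable A /\
  exists (k : T -> nat) (C : nat -> set K),
    [/\ forall j, measurable (k @^-1` [set j]), forall j, compact (C j) &
        A = [set s | C (k (x s)) (y s)]].

Definition compact_fibred_delta A :=
  exists2 B : (set S)^nat, (forall j, compact_fibred (B j)) & A = \bigcap_j B j.

Lemma compact_fibred_cylinder (B : set T) (C : set K) :
  measurable B -> compact C -> measurable (y @^-1` C) ->
  compact_fibred [set s | B (x s) /\ C (y s)].
Proof.
move=> mB cC mC; split.
  by apply: measurableI => //; exact: measurable_preimageT.
exists (fun t => `[< B t >] : nat), (fun j => if j == 1%N then C else set0).
split.
- move=> [|[|j]].
  + rewrite (_ : _ @^-1` _ = ~` B); first exact: measurableC.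
    apply/seteqP; split=> t /=; first by case: asboolP.
    by move=> Bt; rewrite asboolF.
  + rewrite (_ : _ @^-1` _ = B)//.
    apply/seteqP; split=> t /=; first by case: asboolP.
    by move=> Bt; rewrite asboolT.
  + rewrite (_ : _ @^-1` _ = set0)//; apply/seteqP; split => // t /=.
    by case: asboolP.
- by move=> j; case: ifP => // _; exact: compact0.
- apply/funext => s /=; apply/propext; case: asboolP => Bx /=.
    by split=> [[]|].
  by split=> [[]|].
Qed.

(** Intersection and union are handled together: the index of the result codes
    the pair of the two indices. *)
Lemma compact_fibred_op (op : Prop -> Prop -> Prop) A B :
  (forall U V : set K, compact U -> compact V ->
     compact [set z | op (U z) (V z)]) ->
  (measurable A -> measurable B -> measurable [set s | op (A s) (B s)]) ->
  compact_fibred A -> compact_fibred B ->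
  compact_fibred [set s | op (A s) (B s)].
Proof.
move=> cop mop [mA [k [C [mk cC AE]]]] [mB [l [D [ml cD BE]]]].
split; first exact: mop.
pose dec m : nat * nat := odflt (0, 0)%N (unpickle m).
exists (fun t => pickle (k t, l t)).
exists (fun m => [set z | op (C (dec m).1 z) (D (dec m).2 z)]); split.
- move=> m; pose ij := dec m.
  have [mij|mij] := pselect (pickle ij = m); last first.
    rewrite (_ : _ @^-1` _ = set0)//; apply/seteqP; split => // t /= klm.
    by apply: mij; rewrite /ij /dec -klm pickleK.
  rewrite (_ : _ @^-1` _ = k @^-1` [set ij.1] `&` l @^-1` [set ij.2]).
    exact: measurableI.
  apply/seteqP; split => t /=.
    by move=> klm; rewrite /ij /dec -klm pickleK.
  by move=> [-> ->]; rewrite -mij; case: (ij).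
- by move=> m; exact: cop.
- by rewrite AE BE; apply/funext => s /=; rewrite /dec pickleK.
Qed.

Lemma compact_fibredI A B :
  compact_fibred A -> compact_fibred B -> compact_fibred (A `&` B).
Proof.
apply: compact_fibred_op; last exact: measurableI.
by move=> U V cU cV; apply: compact_closedI => //; exact: compact_closed.
Qed.

Lemma compact_fibredU A B :
  compact_fibred A -> compact_fibred B -> compact_fibred (A `|` B).
Proof. by apply: compact_fibred_op; [exact: compactU|exact: measurableU]. Qed.

Lemma compact_fibred0 : compact_fibred set0.
Proof.
have := compact_fibred_cylinder (@measurable0 _ T) (@compact0 K).
by move=> /(_ measurable0); rewrite (_ : [set s | _ /\ _] = set0)//;
  apply/seteqP; split=> s [].
Qed.

Lemma compact_fibred_deltaW A : compact_fibred A -> compact_fibred_delta A.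
Proof.
by move=> cA; exists (fun=> A) => //; rewrite bigcap_const//; exists 0%N.
Qed.

Lemma measurable_compact_fibred_delta A :
  compact_fibred_delta A -> measurable A.
Proof. by move=> [B cB ->]; apply: bigcapT_measurable => j; case: (cB j). Qed.

Lemma compact_fibred_deltaU A B : compact_fibred_delta A ->
  compact_fibred_delta B -> compact_fibred_delta (A `|` B).
Proof.
move=> [F cF ->] [G cG ->].
pose dec m : nat * nat := odflt (0, 0)%N (unpickle m).
exists (fun m => F (dec m).1 `|` G (dec m).2).
  by move=> m; exact: compact_fibredU.
apply/seteqP; split => s.
  by move=> [Fs|Gs] m _; [left; exact: Fs|right; exact: Gs].
move=> FGs; have [Fs|/existsNP[i Fs]] := pselect (forall i, F i s).
  by left => i _.
right => j _; have := FGs (pickle (i, j)) I; rewrite /dec pickleK /=.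
by case.
Qed.

Lemma compact_fibred_delta_bigcap (F : (set S)^nat) :
  (forall m, compact_fibred_delta (F m)) ->
  compact_fibred_delta (\bigcap_m F m).
Proof.
move=> cF; have /choice[B BF] : forall m, exists B : (set S)^nat,
    (forall j, compact_fibred (B j)) /\ F m = \bigcap_j B j.
  by move=> m; have [B] := cF m; exists B.
pose dec m : nat * nat := odflt (0, 0)%N (unpickle m).
exists (fun m => B (dec m).1 (dec m).2).
  by move=> m; have [] := BF (dec m).1.
apply/seteqP; split => s.
  by move=> Fs m _; have := Fs (dec m).1 I; rewrite (BF _).2; apply.
move=> Bs m _; rewrite (BF m).2 => j _.
by have := Bs (pickle (m, j)) I; rewrite /dec pickleK.
Qed.

Lemma compact_fibred_delta_bigsetU (F : (set S)^nat) m :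
  (forall m, compact_fibred_delta (F m)) ->
  compact_fibred_delta (\big[setU/set0]_(i < m) F i).
Proof.
move=> cF; elim: m => [|m IH].
  by rewrite big_ord0; exact/compact_fibred_deltaW/compact_fibred0.
by rewrite big_ord_recr/=; exact: compact_fibred_deltaU.
Qed.

(** Over each t the sections of the partial intersections decrease and are
    compact, so a point t lies in the projection of the intersection as soon as
    it lies in all the projections. *)
Lemma measurable_projection A : compact_fibred_delta A -> measurable (x @` A).
Proof.
move=> [B cB ->].
pose G m := \bigcap_(j in `I_m.+1) B j.
have cG m : compact_fibred (G m).
  elim: m => [|m IH].
    rewrite (_ : G 0%N = B 0%N)//; apply/seteqP; split=> s.
      by apply.
    by move=> Bs [|].
  rewrite (_ : G m.+1 = G m `&` B m.+1); first exact: compact_fibredI.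
  apply/seteqP; split=> s.
    move=> Gs; split; last exact: (Gs m.+1 (leqnn _)).
    by move=> j /= jm; exact: (Gs j (leqW jm)).
  move=> [Gs Bs] j /=; rewrite ltnS leq_eqVlt => /orP[/eqP ->//|jm].
  exact: Gs.
have dG i j : (i <= j)%N -> G j `<=` G i.
  by move=> ij s Gs l /= li; apply: Gs => /=; rewrite (leq_trans li).
have /choice[k kP] : forall m, exists k : T -> nat, exists C : nat -> set K,
    [/\ forall j, measurable (k @^-1` [set j]), forall j, compact (C j) &
        G m = [set s | C (k (x s)) (y s)]].
  by move=> m; have [_ [k [C ?]]] := cG m; exists k, C.
have /choice[C GE] := kP.
rewrite (_ : x @` _ = \bigcap_m \bigcup_(j in [set j | C m j !=set0])
    (k m @^-1` [set j])).
  apply: bigcapT_measurable => m; apply: bigcup_measurable => j _.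
  by have [] := GE m.
apply/seteqP; split=> t.
  move=> [s Bs <-] m _; exists (k m (x s)) => //=; exists (y s).
  have : G m s by move=> j _; exact: Bs.
  by have [_ _ ->] := GE m.
move=> Ct.
have C0 m : C m (k m t) !=set0.
  by have [j /= Cj kj] := Ct m I; rewrite [k m t]kj.
have GC m t' z : C m (k m t') z <-> exists s, [/\ x s = t', y s = z & G m s].
  have [_ _ GmE] := GE m; split.
    by move=> Cz; have [s [xs ys]] := xy_surj t' z; exists s; split=> //; rewrite GmE/= xs ys.
  by move=> [s [<- <-]]; rewrite GmE.
have [||z Cz] := @decreasing_compacts_meet K (fun m => C m (k m t)) hK _ C0.
- by move=> m; have [] := GE m.
- move=> i j ij z /GC[s [xs ys Gs]]; apply/GC; exists s; split=> //.
  exact: dG Gs.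
have [s [xs ys]] := xy_surj t z; exists s => // j _.
have [_ _ GjE] := GE j; have : G j s by rewrite GjE/= xs ys; exact: Cz.
by apply => /=.
Qed.

Definition inner_approximable D := measurable D /\ forall e : R, (0 < e)%R ->
  exists A, [/\ compact_fibred_delta A, A `<=` D & mu (D `\` A) <= e%:E].

Lemma inner_approximable_compact_fibred D :
  compact_fibred D -> inner_approximable D.
Proof.
move=> cD; split; first by case: cD.
move=> e e0; exists D; split=> //.
  exact: compact_fibred_deltaW.
by rewrite setDv measure0 lee_fin ltW.
Qed.

Lemma inner_approximable_seq (F : (set S)^nat) (e : R) : (0 < e)%R ->
  (forall m, inner_approximable (F m)) ->
  exists A : (set S)^nat, [/\ forall m, compact_fibred_delta (A m),
    forall m, A m `<=` F m & \sum_(0 <= m <oo) mu (F m `\` A m) <= e%:E].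
Proof.
move=> e0 aF; have /choice[A HA] : forall m, exists A,
    [/\ compact_fibred_delta A, A `<=` F m &
        mu (F m `\` A) <= (e / (2 ^ m.+1)%:R)%:E].
  by move=> m; apply: (aF m).2; rewrite divr_gt0// ltr0n expn_gt0.
exists A; split=> [m|m|]; try by have [] := HA m.
have := @epsilon_trick R (fun=> 0) e xpredT (fun=> lexx 0) (ltW e0).
rewrite [X in _ <= X + _]eseries0// [leRHS]add0e; apply: le_trans.
by apply: lee_nneseries => // m _; rewrite add0e; have [] := HA m.
Qed.

Lemma inner_approximable_bigcap (F : (set S)^nat) :
  (forall m, inner_approximable (F m)) -> inner_approximable (\bigcap_m F m).
Proof.
move=> aF; have mF m : measurable (F m) by case: (aF m).
split; first exact: bigcapT_measurable.
move=> e e0; have [A [cA AF Ae]] := inner_approximable_seq e0 aF.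
have mA m := measurable_compact_fibred_delta (cA m).
exists (\bigcap_m A m); split.
- exact: compact_fibred_delta_bigcap.
- by move=> s As m _; exact/AF/As.
- apply: le_trans Ae; apply: measure_sigma_subadditive.
  + by move=> m; exact: measurableD.
  + by apply: measurableD; exact: bigcapT_measurable.
  + move=> s [Fs /existsNP[m /not_implyP[_ As]]].
    by exists m => //; split=> //; exact: Fs.
Qed.

(** The approximants of the pieces are kept up to a finite rank, where their
    union has almost its full mass: only finite unions preserve
    [compact_fibred_delta]. *)
Lemma inner_approximable_bigcup (F : (set S)^nat) :
  (forall m, inner_approximable (F m)) -> inner_approximable (\bigcup_m F m).
Proof.
move=> aF; have mF m : measurable (F m) by case: (aF m).
have mUF : measurable (\bigcup_m F m) by exact: bigcupT_measurable.
split=> // e e0; have e20 : (0 < e / 2)%R by rewrite divr_gt0.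
have [A [cA AF Ae]] := inner_approximable_seq e20 aF.
have mA m := measurable_compact_fibred_delta (cA m).
pose U m := \big[setU/set0]_(i < m) A i.
have mU m : measurable (U m) by apply: bigsetU_measurable => i _; exact: mA.
have ndU i j : (i <= j)%N -> U i `<=` U j by move=> ij; exact: subset_bigsetU.
pose UA := \bigcup_m A m.
have mUA : measurable UA by exact: bigcupT_measurable.
have UE : \bigcap_m (UA `\` U m) = set0.
  apply/seteqP; split=> // s Us; have [[m _ Am] _] := Us 0%N I.
  have [_] := Us m.+1 I; apply; rewrite /U -bigcup_mkord.
  by exists m => /=.
have cvgU : mu (UA `\` U m) @[m --> \oo] --> 0.
  rewrite -(measure0 mu) -UE; apply: nonincreasing_cvg_mu.
  - by rewrite -ge0_fin_numE// fin_num_measure//; exact: measurableD.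
  - by move=> m; exact: measurableD.
  - by rewrite UE.
  - by move=> i j ij; apply/subsetPset; apply: setDS; exact: ndU.
have [m Um] : exists m, mu (UA `\` U m) <= (e / 2)%:E.
  have : \forall m \near \oo, mu (UA `\` U m) < (e / 2)%:E.
    by apply: (cvgU [set z | z < (e / 2)%:E]); apply: open_ereal_lt'; rewrite lte_fin.
  by move=> [m _ /(_ m (leqnn _)) /ltW]; exists m.
exists (U m); split.
- exact: compact_fibred_delta_bigsetU.
- rewrite /U -bigcup_mkord => s [j _ As]; exists j => //; exact: AF.
- rewrite [e]splitr EFinD; apply: (@le_trans _ _
    (mu (\bigcup_m (F m `\` A m) `|` (UA `\` U m)))).
    apply: le_measure; rewrite ?inE.
    + exact: measurableD.
    + apply: measurableU; last exact: measurableD.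
      by apply: bigcupT_measurable => j; exact: measurableD.
    + move=> s [[j _ Fs] Us]; have [As|As] := pselect (A j s).
        by right; split=> //; exists j.
      by left; exists j.
  apply: (le_trans (measureU2 _ _ _)).
  + by apply: bigcupT_measurable => j; exact: measurableD.
  + exact: measurableD.
  + apply: leeD => //; apply: le_trans Ae; apply: measure_sigma_subadditive => //.
    * by move=> j; exact: measurableD.
    * by apply: bigcupT_measurable => j; exact: measurableD.
Qed.

(** Complements are not under control by themselves, hence the symmetric
    condition. *)
Lemma sigma_algebra_inner_approximable : inner_approximable setT ->
  sigma_algebra setT
    [set D | inner_approximable D /\ inner_approximable (~` D)].
Proof.
move=> aT; split=> [|D [aD aDC]|F aF].
- split; last by rewrite setC0.
  exact/inner_approximable_compact_fibred/compact_fibred0.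
- by rewrite setTD; split; rewrite ?setCK.
- split; first by apply: inner_approximable_bigcup => m; case: (aF m).
  rewrite setC_bigcup; apply: inner_approximable_bigcap => m.
  by case: (aF m).
Qed.

End inner_approximation.

Definition response_space (R : realType) (n : nat) : topologicalType :=
  prod_topology (fun _ : 'I_n => R).

Section sample_space.
Context {R : realType} {d n : nat}.
Local Notation point := (d.-tuple R * R)%type.
Local Notation K := (response_space R n).

Definition responses (s : n.-tuple point) : K := fun i => (tnth s i).2.

Lemma design_responses_surj (t : n.-tuple (d.-tuple R)) (z : K) :
  exists s, design s = t /\ responses s = z.
Proof.
exists [tuple (tnth t i, z i) | i < n]; split.
  by apply: eq_from_tnth => i; rewrite !tnth_mktuple.
by apply/funext => i; rewrite /responses tnth_mktuple.
Qed.

Lemma hausdorff_responses : hausdorff_space K.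
Proof. by apply: hausdorff_product => _; exact: Rhausdorff. Qed.

Variable mu : {finite_measure set (n.-tuple point) -> \bar R}.
Local Notation approximable := (inner_approximable (@design R d n) responses mu).

Lemma measurable_response i :
  measurable_fun setT (fun s : n.-tuple point => (tnth s i).2).
Proof. by apply: measurableT_comp => //; exact: measurable_tnth. Qed.

(** A response interval that is open or unbounded is a countable union of
    compact ones. *)
Lemma approximable_slabs (D : set (n.-tuple point)) (B : set (n.-tuple (d.-tuple R)))
    (a b : nat -> 'I_n -> R) : measurable B ->
  D = \bigcup_m [set s | B (design s) /\
    (forall j, a m j <= (tnth s j).2 <= b m j)%R] ->
  approximable D.
Proof.
move=> mB ->; apply: inner_approximable_bigcup; first exact: measurable_design.
move=> m; apply: inner_approximable_compact_fibred.
pose C : set K := [set z | forall j, `[a m j, b m j]%classic (z j)].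
have cC : compact C.
  apply: (@tychonoff 'I_n (fun=> R) (fun j => `[a m j, b m j]%classic)) => j.
  exact: segment_compact.
have mC : measurable (responses @^-1` C).
  rewrite (_ : _ @^-1` _ = \big[setI/setT]_(j < n)
      ((fun s => (tnth s j).2) @^-1` `[a m j, b m j]%classic)).
    apply: bigsetI_measurable => j _; apply: measurable_preimageT => //.
    exact: measurable_response.
  rewrite -bigcap_seq; apply/seteqP; split=> s /= Cs j.
    by move=> _; exact: Cs.
  by apply: (Cs j) => /=; rewrite mem_index_enum.
rewrite (_ : [set s | _] = [set s | B (design s) /\ C (responses s)]).
  have cyl := compact_fibred_cylinder (@measurable_design R d n) mB cC mC.
  exact cyl.
by apply/seteqP; split=> s [Bs Cs]; split.
Qed.

Let bounded (z : 'I_n -> R) : exists m : nat, forall j, (- m%:R <= z j <= m%:R)%R.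
Proof.
exists (\max_j Num.bound `|z j|%R) => j; rewrite -ler_norml.
apply: le_trans (ltW (archi_boundP (normr_ge0 (z j)))) _.
by rewrite ler_nat; exact: (@leq_bigmax _ (fun j => Num.bound `|z j|%R)).
Qed.

Lemma approximable_design (A : set (n.-tuple (d.-tuple R))) :
  measurable A -> approximable (@design R d n @^-1` A).
Proof.
move=> mA; apply: (@approximable_slabs _ A (fun m _ => - m%:R)%R
  (fun m _ => m%:R)%R mA).
apply/seteqP; split=> s; last by move=> [m _ []].
by move=> As; have [m bm] := bounded (responses s); exists m.
Qed.

Lemma approximable_response_gt i r :
  approximable [set s | r < (tnth s i).2]%R.
Proof.
apply: (@approximable_slabs _ setT
  (fun m j => if j == i then r + m.+1%:R^-1 else - m%:R)%R
  (fun m _ => m%:R)%R measurableT).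
apply/seteqP; split=> s /=; last first.
  move=> [m _ [_ /(_ i)]]; rewrite eqxx => /andP[rm _].
  by apply: lt_le_trans rm; rewrite ltrDl invr_gt0.
move=> rs; have [m bm] := bounded (responses s).
set y := (tnth s i).2 in rs; pose k := Num.bound ((y - r)^-1).
have yr : (0 < y - r)%R by rewrite subr_gt0.
exists (maxn m k) => //; split=> // j; have /andP[b1 b2] := bm j.
have mk : (m%:R <= (maxn m k)%:R :> R)%R by rewrite ler_nat leq_maxl.
apply/andP; split; last exact: le_trans mk.
case: eqP => [->|_]; last by apply: le_trans b1; rewrite lerN2.
rewrite -lerBrDl invf_ple ?posrE// -/y.
apply: (le_trans (ltW (archi_boundP _))); first by rewrite invr_ge0 ltW.
by rewrite ler_nat leqW// leq_maxr.
Qed.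

Lemma approximable_response_le i r :
  approximable [set s | (tnth s i).2 <= r]%R.
Proof.
apply: (@approximable_slabs _ setT (fun m _ => - m%:R)%R
  (fun m j => if j == i then Num.min r m%:R else m%:R)%R measurableT).
apply/seteqP; split=> s /=; last first.
  move=> [m _ [_ /(_ i)]]; rewrite eqxx => /andP[_ rm].
  by apply: le_trans rm _; rewrite ge_min lexx.
move=> rs; have [m bm] := bounded (responses s).
exists m => //; split=> // j; have /andP[b1 b2] := bm j; rewrite b1/=.
by case: eqP => [ji|//]; rewrite le_min b2 andbT ji.
Qed.

(** Events about the design and half-lines in one response generate the events
    about the sample, and these generators and their complements are unions of
    slabs. *)
Lemma inner_approximable_sample (D : set (n.-tuple point)) :
  measurable D -> approximable D.
Proof.
pose M := [set D : set (n.-tuple point) | approximable D /\ approximable (~` D)].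
have sM : sigma_algebra setT M.
  apply: sigma_algebra_inner_approximable; first exact: measurable_design.
  by rewrite -(preimage_setT (@design R d n)); exact: approximable_design.
have sMpre (U : Type) (f : n.-tuple point -> U) :
    sigma_algebra setT [set B | M (f @^-1` B)].
  case: sM => M0 MC MU; split => [|B|F]; first by rewrite /= preimage_set0.
    by move=> /MC; rewrite /= !setTD preimage_setC.
  by rewrite /= preimage_bigcup; exact: MU.
suff : @measurable _ (n.-tuple point) `<=` M by move=> + mD => /(_ D mD)[].
apply: smallest_sub => // A; rewrite -bigcup_seq => -[i _ [C mC <-{A}]].
rewrite setTI; move: C mC; apply: smallest_sub; first exact: sMpre.
rewrite subUset; split=> A [B mB <-{A}]; rewrite setTI /=.
  have -> : (@tnth n point)^~ i @^-1` (fst @^-1` B) =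
      @design R d n @^-1` ((fun t => tnth t i) @^-1` B).
    by apply/seteqP; split=> s /=; rewrite tnth_mktuple.
  rewrite /M/= preimage_setC; split; apply: approximable_design.
    by apply: measurable_preimageT mB; exact: measurable_tnth.
  by apply: measurableC; apply: measurable_preimageT mB; exact: measurable_tnth.
move: B mB; rewrite -[measurable]/(measurable : set (set (measurableTypeR R))).
rewrite RGenOInfty.measurableE.
apply: smallest_sub; first exact: (sMpre _ (fun s => (tnth s i).2)).
move=> _ [r ->]; split.
  rewrite (_ : _ @^-1` _ = [set s | r < (tnth s i).2]%R).
    exact: approximable_response_gt.
  by apply/seteqP; split=> s /=; rewrite in_itv/= andbT.
rewrite (_ : ~` _ = [set s | (tnth s i).2 <= r]%R).
  exact: approximable_response_le.
by apply/seteqP; split=> s /=; rewrite in_itv/= andbT => rs;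
  [rewrite leNgt; apply/negP|apply/negP; rewrite -leNgt].
Qed.
End sample_space.

(** * The union bound for a nonmeasurable selection *)

Lemma measure_bigsetU_le (R : realType) d (S : measurableType d)
    (mu : {measure set S -> \bar R}) (I : Type) (r : seq I) (Q : pred I)
    (F : I -> set S) :
  (forall i, Q i -> measurable (F i)) ->
  mu (\big[setU/set0]_(i <- r | Q i) F i) <= \sum_(i <- r | Q i) mu (F i).
Proof.
move=> mF; elim: r => [|i r IH]; first by rewrite !big_nil measure0.
rewrite !big_cons; case: ifPn => // Qi.
apply: le_trans (measureU2 _ _ _) _.
- exact: mF.
- exact: bigsetU_measurable.
- exact: leeD.
Qed.

Lemma measure_partition (R : realType) d (S : measurableType d)
    (mu : {measure set S -> \bar R}) (I : finType) (f : S -> I) :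
  (forall i, measurable (f @^-1` [set i])) ->
  \sum_i mu (f @^-1` [set i]) = mu setT.
Proof.
move=> mf; rewrite fsbig_seq ?index_enum_uniq//.
rewrite -measure_fin_bigcup//.
- congr (mu _); apply/seteqP; split=> // s _.
  by exists (f s) => //=; rewrite mem_index_enum.
- by move=> i j _ _ [s [/= <- <-]].
Qed.

Section selection.
Context {R : realType} {dS dT : measure_display} {S : measurableType dS}
  {T : measurableType dT} {K : topologicalType} (x : S -> T) (y : S -> K)
  (mu : {finite_measure set S -> \bar R}).
Hypotheses (hK : hausdorff_space K) (mx : measurable_fun setT x)
  (xy_surj : forall t z, exists s, x s = t /\ y s = z)
  (approx : forall D, measurable D -> inner_approximable x y mu D).
Variables (J : finType) (E : J -> set S) (N : T -> {set J}) (m : nat) (q : R).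
Hypotheses (mE : forall j, measurable (E j))
  (Nm : forall t, (#|N t| <= m)%N) (q0 : (0 <= q)%R)
  (Eq : forall B j, measurable B ->
     mu (x @^-1` B `&` E j) <= q%:E * mu (x @^-1` B)).

(** The union bound survives a nonmeasurable selection N, because N only matters
    through the lists of events that D uses over each t, and these lists can be
    read off from finitely many measurable projections. *)
Lemma measure_selected_le (D : set S) : measurable D ->
  (forall s, D s -> exists2 j, j \in N (x s) & E j s) ->
  mu D <= (m%:R * q)%:E * mu setT.
Proof.
move=> mD DN; apply/lee_addgt0Pr => e e0.
pose pat s : {set J} := [set j | `[< E j s >]]%SET.
have mpat G : measurable (pat @^-1` [set G]).
  rewrite (_ : _ @^-1` _ = \big[setI/setT]_(j : J)
      (if j \in G then E j else ~` E j)).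
    by apply: bigsetI_measurable => j _; case: ifP => // _; exact: measurableC.
  rewrite -bigcap_seq; apply/seteqP; split=> s /=.
    move=> <- j _ /=; rewrite inE; case: asboolP => //.
  move=> Es; apply/setP => j; rewrite inE; have := Es j.
  rewrite /= mem_index_enum => /(_ isT).
  by case: ifP => _; [exact: asboolT|exact: asboolF].
(* Splitting D by the exact list G of the events that hold makes one point of
   a piece informative for the others: an event selected there is in G. *)
pose DG G := D `&` pat @^-1` [set G].
have mDG G : measurable (DG G) by exact: measurableI.
pose k := #|{: {set J}}|.
have k0 : (0 < k)%N by apply/card_gt0P; exists finset.set0.
have ek0 : (0 < e / k%:R)%R by rewrite divr_gt0// ltr0n.
have /choice[L HL] : forall G, exists L,
    [/\ compact_fibred_delta x y L, L `<=` DG G & mu (DG G `\` L) <= (e / k%:R)%:E].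
  by move=> G; exact: (approx (mDG G)).2.
have mL G : measurable (L G).
  by have [cL _ _] := HL G; exact: measurable_compact_fibred_delta cL.
have mxL G : measurable (x @` L G).
  by have [cL _ _] := HL G; exact: measurable_projection cL.
(* Unlike N, this function of t is measurable. *)
pose Ga t : {set {set J}} := [set G | `[< (x @` L G) t >]]%SET.
have mGa La : measurable (Ga @^-1` [set La]).
  rewrite (_ : _ @^-1` _ = \big[setI/setT]_(G : {set J})
      (if G \in La then x @` L G else ~` (x @` L G))).
    by apply: bigsetI_measurable => G _; case: ifP => // _; exact: measurableC.
  rewrite -bigcap_seq; apply/seteqP; split=> t /=.
    by move=> <- G _ /=; rewrite inE; case: asboolP.
  move=> Lt; apply/setP => G; rewrite inE; have := Lt G.
  rewrite /= mem_index_enum => /(_ isT).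
  by case: ifP => _; [exact: asboolT|exact: asboolF].
(* The selection N t0 at one t0 with Ga t0 = La serves all the t with the same
   value: it meets every G in La, as L G has a point over t0. *)
have /choice[Phi HPhi] : forall La, exists Phi : {set J}, (#|Phi| <= m)%N /\
    forall t, Ga t = La -> forall s, x s = t -> (exists G, L G s) ->
      exists2 j, j \in Phi & E j s.
  move=> La; have [[t0 t0La]|noLa] := pselect (exists t, Ga t = La); last first.
    exists finset.set0; rewrite cards0; split=> // t tLa.
    by exfalso; apply: noLa; exists t.
  exists (N t0); split=> // t tLa s xs [G LGs].
  have : G \in Ga t0.
    by rewrite t0La -tLa inE; apply/asboolP; exists s.
  rewrite inE => /asboolP[s0 LGs0 xs0].
  have [_ /(_ _ LGs0)[Ds0 pats0] _] := HL G.
  have [_ /(_ _ LGs)[_ pats] _] := HL G.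
  have [j jN Ejs0] := DN _ Ds0; exists j; first by rewrite -xs0.
  have : j \in pat s0 by rewrite inE; apply/asboolP.
  by rewrite pats0 -pats inE => /asboolP.
have mGax La : measurable ((Ga \o x) @^-1` [set La]).
  by rewrite comp_preimage; exact: measurable_preimageT.
pose U := \big[setU/set0]_(La : {set {set J}}) \big[setU/set0]_(j in Phi La)
   (x @^-1` (Ga @^-1` [set La]) `&` E j).
have mxE La j : measurable (x @^-1` (Ga @^-1` [set La]) `&` E j).
  by apply: measurableI => //; exact: measurable_preimageT.
have mU : measurable U.
  by apply: bigsetU_measurable => La _; exact: bigsetU_measurable.
pose V := \big[setU/set0]_(G : {set J}) (DG G `\` L G).
have mDL G : measurable (DG G `\` L G) by exact: measurableD.
have mV : measurable V by exact: bigsetU_measurable.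
apply: (@le_trans _ _ (mu (U `|` V))).
  apply: le_measure; rewrite ?inE//; first exact: measurableU.
  move=> s Ds; have [Ls|Ls] := pselect (L (pat s) s); last first.
    right; rewrite /V -bigcup_seq; exists (pat s) => //=.
    by rewrite mem_index_enum.
  left; rewrite /U -bigcup_seq; exists (Ga (x s)).
    by rewrite /= mem_index_enum.
  have [_ HP] := HPhi (Ga (x s)).
  have [|j jP Ej] := HP _ erefl s erefl; first by exists (pat s).
  by rewrite (bigD1 j)//=; left.
apply: (le_trans (measureU2 _ mU mV)); apply: leeD.
- apply: (le_trans (measure_bigsetU_le _ _ _)).
    by move=> La _; exact: bigsetU_measurable.
  apply: (@le_trans _ _ (\sum_(La : {set {set J}})
      (m%:R * q)%:E * mu ((Ga \o x) @^-1` [set La]))).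
    apply: lee_sum => La _.
    apply: (le_trans (measure_bigsetU_le _ _ _)) => //.
    apply: (@le_trans _ _ (\sum_(j in Phi La)
        q%:E * mu ((Ga \o x) @^-1` [set La]))).
      by apply: lee_sum => j _; exact: Eq.
    have muf : mu ((Ga \o x) @^-1` [set La]) \is a fin_num.
      exact: fin_num_measure.
    rewrite -(fineK muf) -!EFinM sumEFin lee_fin sumr_const.
    rewrite -[leLHS]mulr_natl mulrA ler_wpM2r ?fine_ge0//.
    by rewrite ler_wpM2r// ler_nat; have [] := HPhi La.
  by rewrite -ge0_sume_distrr// measure_partition.
- apply: (le_trans (measure_bigsetU_le _ _ _)) => //.
  apply: (@le_trans _ _ (\sum_(G : {set J}) (e / k%:R)%:E)).
    by apply: lee_sum => G _; have [] := HL G.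
  rewrite sumEFin lee_fin sumr_const -/k -[leLHS]mulr_natr divfK//.
  by rewrite pnatr_eq0 -lt0n.
Qed.
End selection.

(** * The error at a point in terms of the residuals *)

Section deterministic_bound.
Context {R : realType} {d : nat}.
Implicit Types (g : d.-tuple R -> R) (A : set (d.-tuple R)).

Lemma dist2_ge0 (a b : d.-tuple R) : (0 <= dist2 a b)%R.
Proof. exact: sqrtr_ge0. Qed.

(** A finite Lipschitz constant L is assumed for the sake of coincident points,
    since g must then take equal values at points at distance zero. *)
Lemma lipschitz_const_diam2_ge g A L a b : lipschitz_with g A L ->
  A a -> A b ->
  (`|g a - g b|)%:E <= lipschitz_const g A * diam2 A.
Proof.
move=> gL Aa Ab.
have lip0 : (0 : \bar R) <= lipschitz_const g A.
  by apply: le_ereal_inf_tmp => _ [l [l0 _] <-]; rewrite lee_fin.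
have diamab : (dist2 a b)%:E <= diam2 A.
  by apply: ereal_sup_ubound; exists (a, b).
apply: le_trans (lee_wpmul2l lip0 diamab).
have := dist2_ge0 a b; rewrite le_eqVlt => /orP[/eqP d0|d0].
  rewrite -d0 mule0 lee_fin; apply: le_trans (gL a b Aa Ab) _.
  by rewrite -d0 mulr0.
rewrite -lee_pdivrMr//; apply: le_ereal_inf_tmp => _ [l [l0 gl] <-].
by rewrite lee_fin ler_pdivrMr//; exact: gl.
Qed.
End deterministic_bound.

Section local_error.
Context {R : realType} {d n : nat}.
Local Notation point := (d.-tuple R * R)%type.
Implicit Types (s : n.-tuple point) (A : set (d.-tuple R)).

Definition cell_indices s A : {set 'I_n} :=
  [set i : 'I_n | `[< A (tnth s i).1 >]]%SET.

Lemma sum_indic_cell s A (f : 'I_n -> R) :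
  (\sum_(i < n) f i * \1_A (tnth s i).1 =
   \sum_(i in cell_indices s A) f i)%R.
Proof.
rewrite [RHS]big_mkcond; apply: eq_bigr => i _; rewrite inE indicE.
have [Ai|Ai] := pselect (A (tnth s i).1).
  by rewrite (asboolT Ai) mem_set// mulr1.
by rewrite (asboolF Ai) memNset// mulr0.
Qed.

Lemma sum_indic_card s A :
  (\sum_(i < n) \1_A (tnth s i).1 = #|cell_indices s A|%:R :> R)%R.
Proof.
transitivity (\sum_(i < n) 1 * \1_A (tnth s i).1 : R)%R.
  by apply: eq_bigr => i _; rewrite mul1r.
by rewrite sum_indic_cell sumr_const.
Qed.

Lemma local_estimator_error g A s x (L : R) : lipschitz_with g A L -> A x ->
  (0 < #|cell_indices s A|)%N ->
  (`|local_estimator s A - g x|)%:E <=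
  (`|residual_sum g (enum (cell_indices s A)) s| /
     #|cell_indices s A|%:R)%:E + lipschitz_const g A * diam2 A.
Proof.
move=> gL Ax; set I := cell_indices s A => I0.
have gI i : i \in I -> (`|g (tnth s i).1 - g x|)%:E <= lipschitz_const g A * diam2 A.
  by rewrite inE => /asboolP Ai; exact: lipschitz_const_diam2_ge gL _ Ax.
have B0 := lipschitz_const_diam2_ge gL Ax Ax.
move: gI B0; case: (_ * _) => [r gI _|_ _|_]; last 2 first.
- by rewrite addey// leey.
- by rewrite leeNy_eq.
have k0 : (0 < #|I|%:R :> R)%R by rewrite ltr0n.
rewrite -EFinD lee_fin.
have -> : (local_estimator s A - g x = (residual_sum g (enum I) s +
    \sum_(i in I) (g (tnth s i).1 - g x)) / #|I|%:R)%R.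
  rewrite /local_estimator sum_indic_cell sum_indic_card -/I.
  rewrite /residual_sum big_enum -big_split/=.
  rewrite -[X in (_ - X)%R](mulfK (lt0r_neq0 k0)) -mulrBl; congr (_ / _)%R.
  rewrite mulr_natr -sumr_const -sumrB; apply: eq_bigr => i _.
  by rewrite addrA subrK.
rewrite normrM normfV (gtr0_norm k0) ler_pdivrMr// mulrDl divfK ?lt0r_neq0//.
apply: le_trans (ler_normD _ _) _; rewrite lerD2l.
apply: le_trans (ler_norm_sum _ _ _) _.
rewrite mulr_natr -sumr_const; apply: ler_sum => i iI.
by have := gI i iI; rewrite lee_fin.
Qed.

Lemma local_error_le g sigma delta v A s x (L : R) :
  lipschitz_with g A L -> A x ->
  (`|residual_sum g (enum (cell_indices s A)) s| <=
   Num.sqrt (2 * sigma ^+ 2 * ln (n.+1%:R ^+ v / delta) *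
             #|cell_indices s A|%:R))%R ->
  (`|local_estimator s A - g x|)%:E <= error_bound g sigma delta v s A.
Proof.
move=> gL Ax; set I := cell_indices s A; set b := (2 * _ * _)%R => resb.
rewrite /error_bound /empirical_measure sum_indic_card -/I -/b.
case: ifPn => [|I0]; first by rewrite leey.
have {}I0 : (0 < #|I|)%N.
  by rewrite lt0n; apply: contra I0 => /eqP ->; rewrite mulr0.
apply: le_trans (local_estimator_error gL Ax I0) _; rewrite -/I.
apply: leeD => //; rewrite lee_fin.
have nR : (n%:R != 0 :> R)%R.
  rewrite pnatr_eq0 -lt0n; have /card_gt0P[i _] := I0.
  exact: leq_ltn_trans (ltn_ord i).
have k0 : (0 < #|I|%:R :> R)%R by rewrite ltr0n.
rewrite mulrA divff// mul1r ler_pdivrMr//.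
apply: le_trans resb _.
have -> : (b * #|I|%:R = #|I|%:R ^+ 2 * (b / #|I|%:R))%R.
  by field; rewrite lt0r_neq0.
by rewrite sqrtrM ?sqr_ge0// sqrtr_sqr (ger0_norm (ltW k0)) mulrC.

Qed.
End local_error.

(** * Outer probability of the good event *)

(** Projecting D to the first factor could leave the measurable sets; the set of
    the s to whose section the kernel gives positive mass is measurable, lies
    inside the projection, and carries all the mass of D. *)
Lemma drawn_given_shadow (R : realType) (dO dS dU : measure_display)
    (Omega : measurableType dO) (P : probability Omega R)
    (TS : measurableType dS) (TU : measurableType dU)
    (S : Omega -> TS) (U : Omega -> TU) (D : set (TS * TU)) :
  measurable_fun setT S -> drawn_given P S U -> measurable D ->
  exists D' : set TS, [/\ measurable D', D' `<=` [set s | exists u, D (s, u)] &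
    P [set w | D (S w, U w)] <= P (S @^-1` D')].
Proof.
move=> mS [kappa kE] mD.
have mk : measurable_fun setT (fun s => kappa s (xsection D s)).
  by apply: measurable_fun_xsection_finite_kernel; exact: mem_set.
pose D' := [set s | 0 < kappa s (xsection D s)].
have mD' : measurable D'.
  rewrite (_ : D' = (fun s => kappa s (xsection D s)) @^-1` `]0, +oo[%classic).
    by apply: (measurable_preimageT mk); exact: emeasurable_itv.
  by apply/seteqP; split=> s; rewrite /D'/= in_itv/= andbT.
exists D'; split=> // [s D's|].
  have [u Du] : xsection D s !=set0.
    by apply/set0P/eqP => D0; move: D's; rewrite /D'/= D0 measure0 ltxx.
  by exists u; move: Du; rewrite /xsection/= inE.
have mSD' : measurable (S @^-1` D') by exact: (measurable_preimageT mS mD').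
have -> : P (S @^-1` D') = \int[P]_w (\1_(S @^-1` D') w)%:E.
  by have /= := @integral_indic _ _ _ P setT measurableT _ mSD'; rewrite setIT.
rewrite kE//; apply: ge0_le_integral => //.
- exact: (measurableT_comp mk mS).
- exact/measurable_EFinP.
- move=> w _; rewrite indicE; have [_|] := boolP (w \in S @^-1` D').
    apply: (@le_trans _ _ (kappa (S w) setT)).
      by apply: le_measure; rewrite ?inE//; exact: measurable_xsection.
    by rewrite prob_kernel.
  by rewrite notin_setE /D'/= => /negP; rewrite -leNgt.
Qed.

Lemma mu_ext_ge_complement (R : realType) d (T : measurableType d)
    (mu : {measure set T -> \bar R}) (G : set T) (a : R) : mu setT = 1 ->
  (forall D, measurable D -> D `<=` ~` G -> mu D <= a%:E) ->
  (1 - a)%:E <= mu_ext mu G.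
Proof.
move=> muT muD; apply: le_ereal_inf_tmp => _ [F [mF GF] <-].
pose W := \bigcup_k F k.
have mW : measurable W by exact: bigcupT_measurable.
have muW : mu W <= \sum_(0 <= k <oo) mu (F k).
  exact: measure_sigma_subadditive.
apply: le_trans muW; rewrite EFinB leeBlDr//.
apply: (@le_trans _ _ (mu W + mu (~` W))).
  rewrite -measureU//; last by rewrite setICr.
    by rewrite setUv -muT.
  exact: measurableC.
rewrite leeD2l//; apply: muD; first exact: measurableC.
exact: subsetC.
Qed.

Theorem theorem4 (R : realType) (d n v : nat) (delta sigma : R)
  (dO : measure_display) (Omega : measurableType dO) (P : probability Omega R)
  (SX : set (d.-tuple R))
  (X : {RV P >-> d.-tuple R}) (Y : {RV P >-> R}) (g : d.-tuple R -> R)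
  (X_ : 'I_n -> {RV P >-> d.-tuple R}) (Y_ : 'I_n -> {RV P >-> R})
  (dU : measure_display) (TU : measurableType dU) (U : {RV P >-> TU})
  (V : n.-tuple (d.-tuple R * R) -> TU -> d.-tuple R -> set (d.-tuple R))
  (hd : (1 <= d)%N) (hn : (1 <= n)%N)
  (hdelta : (0 < delta < 1 / 2)%R)
  (hX : {ae P, forall w, SX (X w)})
  (hg : cond_expectation X Y g)
  (hiid : iid_copies X_ Y_ X Y)
  (hsub : cond_subgaussian X (noise X Y g) sigma)
  (hlip : exists L : R, lipschitz_with g SX L)
  (hU : drawn_given P (sample X_ Y_) U)
  (hV : forall s u, local_map SX (V s u))
  (hVC : vc_local_map SX V v) :
  (1 - 2 * delta)%:E <=
  mu_ext (joint_law X_ Y_ U)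
    [set su | forall x, SX x ->
       (`|local_estimator su.1 (V su.1 su.2 x) - g x|)%:E <=
       error_bound g sigma delta v su.1 (V su.1 su.2 x)].
Proof.
set good := [set su | _].
have mg : measurable_fun setT g by case: hg.
have [L gL] := hlip; have [C vcC VC] := hVC.
have /andP[delta0 delta12] := hdelta.
pose S : measurableType _ := n.-tuple (d.-tuple R * R).
pose La := ln (n.+1%:R ^+ v / delta)%R.
have N0 : (0 < n.+1%:R ^+ v :> R)%R by rewrite exprn_gt0.
have N1 : (1 <= n.+1%:R ^+ v :> R)%R by rewrite exprn_ege1// ler1n.
have La0 : (0 <= La)%R.
  by rewrite ln_ge0// ler_pdivlMr// mul1r; apply: le_trans N1; lra.
have expLa : (expR (- La) = delta / n.+1%:R ^+ v)%R.
  by rewrite expRN lnK ?posrE ?divr_gt0// invf_div.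
pose E (I : {set 'I_n}) : set S := [set s |
  (Num.sqrt (2 * sigma ^+ 2 * La * #|I|%:R) < `|residual_sum g (enum I) s|)%R].
have mE I : measurable (E I).
  rewrite (_ : E I = (fun s => `|residual_sum g (enum I) s|)%R @^-1`
      `]Num.sqrt (2 * sigma ^+ 2 * La * #|I|%:R), +oo[%classic).
    apply: measurable_preimageT => //.
    by apply: measurableT_comp => //; exact: measurable_residual_sum.
  by apply/seteqP; split=> s; rewrite /E/= in_itv/= andbT.
pose Nt (t : n.-tuple (d.-tuple R)) := traces C (tnth t).
(* The design alone determines which events are selected; the choice of x and u
   only decides which of them is the culprit. *)
have badE s u : ~ good (s, u) -> exists2 I, I \in Nt (design s) & E I s.
  move=> /existsNP[x /not_implyP[SXx bad]].
  pose A := V s u x; have [Ax ASX _ _] := hV s u x SXx.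
  have gLA : lipschitz_with g A L by move=> a b Aa Ab; apply: gL; exact: ASX.
  exists (cell_indices s A).
    rewrite inE; apply/asboolP; exists A; first exact: VC.
    by move=> i; rewrite tnth_mktuple inE; split=> [/asboolP|Ai]//; apply/asboolP.
  rewrite /E/= ltNge; apply/negP => le_res; apply: bad.
  exact: local_error_le gLA Ax le_res.
have msm : measurable_fun setT (sample X_ Y_) := measurable_sample X_ Y_.
pose sm : {mfun Omega >-> S} := mfun_Sub (mem_set msm).
pose mu : probability S R := distribution P sm.
have bound D : measurable D ->
    (forall s, D s -> exists2 I, I \in Nt (design s) & E I s) ->
    mu D <= (2 * delta)%:E.
  move=> mD DN.
  apply: le_trans (measure_selected_le (q := (2 * (delta / n.+1%:R ^+ v))%R)
    (m := (n.+1 ^ v)%N) (E := E) (N := Nt)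
    hausdorff_responses (@measurable_design R d n)
    (@design_responses_surj R d n) (@inner_approximable_sample R d n mu)
    _ _ _ _ mD DN) _ => //.
  - by move=> t; exact: card_traces.
  - by rewrite mulr_ge0// divr_ge0// ltW.
  - move=> B I mB; rewrite -expLa.
    have := subgaussian_tail hiid mg hsub La0 (enum_uniq I) mB.
    by rewrite -cardE.
  - rewrite [X in _ * X](probability_setT mu) mule1 lee_fin natrX.
    by rewrite le_eqVlt; apply/orP; left; apply/eqP; field; rewrite lt0r_neq0.
have mSU : measurable_fun setT (fun w => (sample X_ Y_ w, U w)).
  exact: measurable_fun_pair.
pose jl := measure_function_pushforward__canonical__measure_function_Measure P mSU.
apply: (@mu_ext_ge_complement _ _ _ jl).
  by rewrite /jl /= /pushforward preimage_setT probability_setT.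
move=> D mD Dbad; have [D' [mD' D'D DD']] := drawn_given_shadow msm hU mD.
apply: (le_trans DD'); apply: (bound D' mD') => s /D'D[u Dsu].
by apply: (@badE s u); exact: Dbad.
Qed.
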